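(* Let $\mathfrak{A}$ be a unital $C^*$-algebra with unit $\boldsymbol{1}$ and let $a\in\mathfrak{A}$ be non-zero. Then the following conditions are equivalent: (i) $a\parallel\boldsymbol{1}$. (ii) $dw_{\mathfrak{A}}(a)=\sqrt{w_{\mathfrak{A}}^2(a)+\|a\|^4}$.
   Context: $\mathfrak{A}$ is a complex unital $C^*$-algebra; its state space $\mathfrak{S}(\mathfrak{A})$ is the set of all positive linear functionals $f\in\mathfrak{A}^*$ with $\|f\|=f(\boldsymbol{1})=1$. For $a\in\mathfrak{A}$: the algebraic numerical radius is $w_{\mathfrak{A}}(a)=\sup\{|f(a)|:f\in\mathfrak{S}(\mathfrak{A})\}$; the algebraic Davis--Wielandt radius is $dw_{\mathfrak{A}}(a)=\sup\{\sqrt{|f(a)|^2+f(a^*a)^2}:f\in\mathfrak{S}(\mathfrak{A})\}$; $w_{\mathfrak{A}}^2(a)=(w_{\mathfrak{A}}(a))^2$. Two elements $a,b\in\mathfrak{A}$ are norm-parallel, written $a\parallel b$, if there exists $\lambda\in\mathbb{T}=\{z\in\mathbb{C}:|z|=1\}$ such that $\|a+\lambda b\|=\|a\|+\|b\|$. *)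

(* Defs.v *)
From HB Require Import structures.
From mathcomp Require Import all_boot all_order all_algebra.
From mathcomp Require Import complex.
From mathcomp Require Import boolp classical_sets reals topology normedtype.

Set Implicit Arguments.
Unset Strict Implicit.
Unset Printing Implicit Defensive.

Import Order.TTheory GRing.Theory Num.Theory.
Import numFieldNormedType.Exports.

Local Open Scope classical_set_scope.
Local Open Scope ring_scope.
Local Open Scope complex_scope.

(* Complex unital C*-algebras, as complete normed modules over R[i] with a
   product, a unit and an involution.  The ring structure is not inherited from
   [GRing.Algebra] because Hierarchy Builder refuses to join it with
   [NormedModule]; the instances below make every [cstarAlgType R] an
   [algType R[i]] for the same addition and scaling.  As usual for [algType],
   1 != 0, so only the zero algebra is left out. *)
HB.mixin Record CompleteNormedModule_isCstarAlgebra (R : realType) A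
    of CompleteNormedModule R[i] A := {
  cmul : A -> A -> A;
  cone : A;
  star : A -> A;
  cmulA : associative cmul;
  cmul1l : left_id cone cmul;
  cmul1r : right_id cone cmul;
  cmulDl : left_distributive cmul +%R;
  cmulDr : right_distributive cmul +%R;
  cmulZl : forall (c : R[i]) (x y : A), c *: cmul x y = cmul (c *: x) y;
  cmulZr : forall (c : R[i]) (x y : A), c *: cmul x y = cmul x (c *: y);
  cone_neq0 : cone != 0;
  cstar_involutive : involutive star;
  cstarD : {morph star : x y / x + y};
  cstarZ : forall (c : R[i]) (x : A), star (c *: x) = c^* *: star x;
  cstarM : forall x y : A, star (cmul x y) = cmul (star y) (star x);
  cnormM : forall x y : A, `|cmul x y| <= `|x| * `|y|;
  cstar_identity : forall x : A, `|cmul (star x) x| = `|x| ^+ 2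
}.

#[short(type="cstarAlgType")]
HB.structure Definition CstarAlgebra (R : realType) :=
  {A of CompleteNormedModule R[i] A & CompleteNormedModule_isCstarAlgebra R A}.

#[non_forgetful_inheritance]
HB.instance Definition _ (R : realType) (A : cstarAlgType R) :=
  GRing.Zmodule_isNzRing.Build (CstarAlgebra.sort A)
    cmulA cmul1l cmul1r cmulDl cmulDr cone_neq0.

#[non_forgetful_inheritance]
HB.instance Definition _ (R : realType) (A : cstarAlgType R) :=
  GRing.LSemiModule_isLSemiAlgebra.Build R[i] (CstarAlgebra.sort A) cmulZl.

#[non_forgetful_inheritance]
HB.instance Definition _ (R : realType) (A : cstarAlgType R) :=
  GRing.LSemiAlgebra_isSemiAlgebra.Build R[i] (CstarAlgebra.sort A) cmulZr.

(* Norms on modules over R[i] take their values in R[i] (as nonnegative reals);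
   [rnorm] is the same norm as an element of R. *)
Definition rnorm (R : realType) (V : normedModType R[i]) (x : V) : R :=
  complex.Re `|x|.

Definition norm_parallel (R : realType) (A : cstarAlgType R) (a b : A) : Prop :=
  exists lambda : R[i], `|lambda| = 1 /\ `|a + lambda *: b| = `|a| + `|b|.

Section States.
Context (R : realType) (A : cstarAlgType R).
Implicit Types (a : A) (f : {linear A -> R[i]^o}).

Definition functional_norm f : R :=
  sup [set rnorm (f x) | x in [set x | rnorm x <= 1]].

(* In R[i], [0 <= z] says that z is a nonnegative real number. *)
Definition positive_functional f : Prop :=
  forall x : A, 0 <= (f (star x * x) : R[i]).

Definition state_space : set {linear A -> R[i]^o} :=
  [set f : {linear A -> R[i]^o} |
    [/\ continuous f, positive_functional f, functional_norm f = 1 & f 1 = 1]].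

Definition numerical_radius a : R :=
  sup ((fun f : {linear A -> R[i]^o} => rnorm (f a)) @` state_space).

(* f (a^* a) is a nonnegative real for every state f, so taking its real part
   only moves it from R[i] to R. *)
Definition davis_wielandt_radius a : R :=
  sup ((fun f : {linear A -> R[i]^o} =>
          Num.sqrt (rnorm (f a) ^+ 2 + complex.Re (f (star a * a)) ^+ 2))
       @` state_space).

End States.

(* Main.v *)
(** Positivity in a C*-algebra is handled through norms: a self-adjoint [h] is
    positive when [`|t - h| <= t] for some [t >= 0].  Square roots come from the
    iteration [p := (k + p^2) / 2], which converges to [1 - sqrt (1 - k)] for
    [`|k| <= 1]; the C*-identity applied to the normal element [k + i s] then shows
    that squares are positive, and the Kelley-Vaught-Kaplansky argument gives
    [x^* x >= 0].  With Hahn-Banach, every positive [b] has a state [f] with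
    [f b = `|b|].

    If [`|a + l| = `|a| + 1] with [`|l| = 1], a state norming
    [(a + l)^* (a + l)] satisfies both [|f a| = `|a|] and [f (a^* a) = `|a|^2],
    so all the bounds are attained simultaneously.

    Conversely, normalize [`|a| = 1] and let [w] be the numerical radius.  The
    equality provides states with [f a] close to [w] (up to a phase) and
    [f (a^* a)] close to [1].  Since [2 w - (a + a^* )] and [1 - a^* a] are positive
    and almost annihilated by [f], the vector [(a - z) x], where [x] is the GNS
    vector of [f] and [z^2 - 2 w z + 1 = 0], [|z| = 1], is almost an eigenvector of
    [a^*] for [z]; were [w < 1], it would stay away from [0] and the corresponding
    vector state would give a numerical radius close to [1].  Hence [w = `|a|], and
    compactness of the unit circle yields a single phase [l]. *)
From HB Require Import structures.
Require Import Defs.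
From mathcomp Require Import all_boot all_order all_algebra.
From mathcomp Require Import complex reals topology normedtype.
From mathcomp Require Import boolp classical_sets realfun derive.
From mathcomp Require Import ring lra.

Set Implicit Arguments.
Unset Strict Implicit.
Unset Printing Implicit Defensive.

Import Order.TTheory GRing.Theory Num.Theory numFieldNormedType.Exports.
Local Open Scope classical_set_scope.
Local Open Scope ring_scope.
Local Open Scope complex_scope.

(** * Real-valued norms on complex normed modules *)

Section Norm.
Context (R : realType) (V : normedModType R[i]).
Implicit Types x y : V.

Lemma rnormE x : `|x| = (rnorm x)%:C.
Proof. by rewrite /rnorm RRe_real // normr_real. Qed.

Lemma rnorm_eq x (t : R) : `|x| = t%:C -> rnorm x = t.
Proof. by rewrite /rnorm => ->. Qed.

Lemma rnorm_ge0 x : 0 <= rnorm x.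
Proof. by rewrite -lecR -rnormE normr_ge0. Qed.

Lemma rnorm0 : rnorm (0 : V) = 0.
Proof. by rewrite /rnorm normr0. Qed.

Lemma rnorm_eq0 x : rnorm x = 0 -> x = 0.
Proof. by move=> x0; apply/eqP; rewrite -normr_eq0 rnormE x0. Qed.

Lemma rnormN x : rnorm (- x) = rnorm x.
Proof. by rewrite /rnorm normrN. Qed.

Lemma rnormBC x y : rnorm (x - y) = rnorm (y - x).
Proof. by rewrite -rnormN opprB. Qed.

Lemma ler_rnormD x y : rnorm (x + y) <= rnorm x + rnorm y.
Proof. by rewrite -lecR -rnormE rmorphD /= -!rnormE ler_normD. Qed.

Lemma ler_rnormB x y : rnorm (x - y) <= rnorm x + rnorm y.
Proof. by rewrite -(rnormN y) ler_rnormD. Qed.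

End Norm.

(** * Norm, involution and real scalars in a C*-algebra *)

Section Star.
Context (R : realType) (A : cstarAlgType R).
Implicit Types (x y z h k s d : A) (t : R).

Lemma rnormZ (c : R[i]) x : rnorm (c *: x) = rnorm (c : R[i]^o) * rnorm x.
Proof.
by apply: rnorm_eq; rewrite normrZ (rnormE x) (rnormE (c : R[i]^o)) rmorphM.
Qed.

Lemma rnorm_real t : rnorm (t%:C : R[i]^o) = `|t|.
Proof. by apply: rnorm_eq; rewrite normc_def /= expr0n addr0 sqrtr_sqr. Qed.

Lemma rnormZr t x : rnorm (t%:C *: x) = `|t| * rnorm x.
Proof. by rewrite rnormZ rnorm_real. Qed.

Lemma rnormM x y : rnorm (x * y) <= rnorm x * rnorm y.
Proof. by rewrite -lecR rmorphM /= -!rnormE; exact: cnormM. Qed.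

Lemma rnorm_star_mul x : rnorm (star x * x) = rnorm x ^+ 2.
Proof. by apply: rnorm_eq; rewrite rmorphXn /= -rnormE; exact: cstar_identity. Qed.

Lemma starD x y : star (x + y) = star x + star y.
Proof. exact: cstarD. Qed.

Lemma starM x y : star (x * y) = star y * star x.
Proof. exact: cstarM. Qed.

Lemma starK x : star (star x) = x.
Proof. exact: cstar_involutive. Qed.

Lemma star0 : star (0 : A) = 0.
Proof. by apply: (addrI (star (0 : A))); rewrite -starD !addr0. Qed.

Lemma starN x : star (- x) = - star x.
Proof. by apply/eqP; rewrite -addr_eq0 -starD addNr star0. Qed.

Lemma starB x y : star (x - y) = star x - star y.
Proof. by rewrite starD starN. Qed.

Lemma star1 : star (1 : A) = 1.
Proof. by rewrite -[LHS]mulr1 -[X in _ * X]starK -starM mulr1 starK. Qed.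

Lemma starZr t x : star (t%:C *: x) = t%:C *: star x.
Proof. by rewrite cstarZ conj_Creal // complex_real. Qed.

(** The C*-identity and submultiplicativity give [|y|^2 <= |y^*| |y|]; cancelling [|y|] yields one
    inequality, and applying it to [y^*] yields the other. *)
Lemma rnorm_star x : rnorm (star x) = rnorm x.
Proof.
suff le_star y : rnorm y <= rnorm (star y).
  by apply/eqP; rewrite eq_le -{2}(starK x) !le_star.
have [y0|y0] := eqVneq (rnorm y) 0; first by rewrite y0 rnorm_ge0.
have ypos : 0 < rnorm y by rewrite lt_def y0 rnorm_ge0.
by rewrite -(ler_pM2r ypos) -expr2 -rnorm_star_mul rnormM.
Qed.

Lemma rnorm_sqr_sa h : star h = h -> rnorm (h * h) = rnorm h ^+ 2.
Proof. by move=> hE; rewrite -rnorm_star_mul hE. Qed.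

Lemma rnorm1 : rnorm (1 : A) = 1.
Proof.
have /eqP := rnorm_sqr_sa star1.
rewrite mulr1 expr2 -subr_eq0 -{1}[rnorm _]mulr1 -mulrBr mulf_eq0 => /orP[/eqP/rnorm_eq0/eqP|].
  by rewrite oner_eq0.
by rewrite subr_eq0 => /eqP.
Qed.

Definition rscalar t : A := t%:C *: 1.

Lemma rnorm_rscalar t : rnorm (rscalar t) = `|t|.
Proof. by rewrite rnormZr rnorm1 mulr1. Qed.

Lemma star_rscalar t : star (rscalar t) = rscalar t.
Proof. by rewrite starZr star1. Qed.

Lemma rscalar1 : rscalar 1 = 1.
Proof. by rewrite /rscalar scale1r. Qed.

Lemma rscalar0 : rscalar 0 = 0.
Proof. by rewrite /rscalar scale0r. Qed.

Lemma rscalarD t u : rscalar (t + u) = rscalar t + rscalar u.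
Proof. by rewrite /rscalar rmorphD scalerDl. Qed.

Lemma rscalarB t u : rscalar (t - u) = rscalar t - rscalar u.
Proof. by rewrite /rscalar rmorphB scalerBl. Qed.

Lemma mul_rscalarl t x : rscalar t * x = t%:C *: x.
Proof. by rewrite /rscalar -scalerAl mul1r. Qed.

Lemma mul_rscalarr t x : x * rscalar t = t%:C *: x.
Proof. by rewrite /rscalar -scalerAr mulr1. Qed.

Lemma conj_conjc (c : R[i]) : Num.conj c = conjc c.
Proof. by []. Qed.

End Star.

(** * Square roots *)

Section SquareRoot.
Context (R : realType) (A : cstarAlgType R).
Implicit Types (x y z h k s d : A) (t : R).

Definition sqrt_step k p : A := (2^-1 : R)%:C *: (k + p * p).
Definition sqrt_iter k n : A := iter n (sqrt_step k) 0.
(** The scalar iteration for [k = 1]. It increases to 1 and majorizes [sqrt_iter k] for every [k] in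
    the unit ball. *)
Definition sqrt_iterR n : R := iter n (fun q => 2^-1 * (1 + q * q)) 0.

(** The error [e = 1 - q] evolves by [e - e^2 / 2], which sends the bound [2 / m] below
    [2 / (m + 1)]. *)
Lemma sqrt_iterR_bounds n :
  0 <= sqrt_iterR n <= 1 /\ 1 - sqrt_iterR n <= 2 / n.+2%:R.
Proof.
elim: n => [|n [/andP[q0 q1] qn]].
  by rewrite /sqrt_iterR /=; split; [lra|rewrite divff ?pnatr_eq0 // subr0].
rewrite /sqrt_iterR iterS -/(sqrt_iterR n); set q := sqrt_iterR n in q0 q1 qn *.
split; first by nra.
have n3 : (n.+3%:R : R) = n.+2%:R + 1 by rewrite -natr1.
have n2 : 2 <= (n.+2%:R : R) by rewrite ler_nat.
rewrite n3; move: qn n2; set m : R := n.+2%:R => qn n2.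
have m0 : 0 < m by lra.
rewrite ler_pdivlMr in qn => //; rewrite ler_pdivlMr; last lra.
set e := 1 - q in qn *; have -> : q = 1 - e by rewrite /e; ring.
have e0 : 0 <= e by rewrite /e; lra.
have e1 : e <= 1 by rewrite /e; lra.
nra.
Qed.

Lemma rnorm_sqr_diff x y :
  rnorm (x * x - y * y) <= rnorm (x - y) * (rnorm x + rnorm y).
Proof.
have -> : x * x - y * y = (x - y) * x + y * (x - y).
  by rewrite mulrBl mulrBr addrA subrK.
apply: le_trans (ler_rnormD _ _) _.
rewrite [leRHS]mulrDr lerD ?rnormM //.
by rewrite mulrC rnormM.
Qed.

Lemma sqrt_iter_bound k n : rnorm k <= 1 -> rnorm (sqrt_iter k n) <= sqrt_iterR n.
Proof.
move=> k1; elim: n => [|n IHn]; first by rewrite /sqrt_iter /= rnorm0.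
rewrite /sqrt_iter /sqrt_iterR !iterS -/(sqrt_iter k n) -/(sqrt_iterR n).
rewrite rnormZr ger0_norm ?invr_ge0 // ler_pM2l ?invr_gt0 //.
apply: le_trans (ler_rnormD _ _) _; rewrite lerD //.
by apply: le_trans (rnormM _ _) _; rewrite ler_pM // rnorm_ge0.
Qed.

(** Majorant argument: the factorization of a difference of squares bounds each increment by the
    same expression in the scalar iterates. *)
Lemma sqrt_iter_step k n : rnorm k <= 1 ->
  rnorm (sqrt_iter k n.+1 - sqrt_iter k n) <= sqrt_iterR n.+1 - sqrt_iterR n.
Proof.
move=> k1; elim: n => [|n IHn].
  rewrite /sqrt_iter /sqrt_iterR /= mul0r addr0 !subr0 rnormZr ger0_norm ?invr_ge0 //.
  by rewrite mulr0 addr0 ler_pM2l ?invr_gt0.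
rewrite {1}/sqrt_iter {1}/sqrt_iterR !iterS -/(sqrt_iter k n) -/(sqrt_iterR n).
rewrite -!/(sqrt_step k _) -/(sqrt_iter k n.+1) -/(sqrt_iterR n.+1).
set p := sqrt_iter k n in IHn *; set q := sqrt_iterR n in IHn *.
set p' := sqrt_iter k n.+1 in IHn *; set q' := sqrt_iterR n.+1 in IHn *.
have -> : sqrt_step k p' - sqrt_step k p = (2^-1 : R)%:C *: (p' * p' - p * p).
  by rewrite /sqrt_step -scalerBr opprD addrACA subrr add0r.
have -> : 2^-1 * (1 + q' * q') - q' = 2^-1 * ((q' - q) * (q' + q)).
  have -> : q' = 2^-1 * (1 + q * q) by []. 
  by field.
rewrite rnormZr ger0_norm ?invr_ge0 // ler_pM2l ?invr_gt0 //.
apply: le_trans (rnorm_sqr_diff _ _) _.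
by rewrite ler_pM ?rnorm_ge0 ?addr_ge0 ?rnorm_ge0 // lerD // sqrt_iter_bound.
Qed.

(** The increments telescope against those of the scalar iteration, so the rate is the same for all
    [k] in the unit ball. *)
Lemma sqrt_iter_cauchy k m n : rnorm k <= 1 -> (m <= n)%N ->
  rnorm (sqrt_iter k n - sqrt_iter k m) <= 2 / m.+2%:R.
Proof.
move=> k1 /subnK <-; apply: (@le_trans _ _ (sqrt_iterR (n - m + m) - sqrt_iterR m)).
  elim: (n - m)%N => [|i IHi]; first by rewrite add0n !subrr rnorm0.
  rewrite addSn -(subrKA (sqrt_iter k (i + m))) -[leRHS](subrKA (sqrt_iterR (i + m))).
  by apply: le_trans (ler_rnormD _ _) _; rewrite lerD // sqrt_iter_step.
have [/andP[_ q1] _] := sqrt_iterR_bounds (n - m + m).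
have [_ qm] := sqrt_iterR_bounds m.
by apply: le_trans qm; rewrite lerB.
Qed.

Lemma harmonic_small t : 0 < t -> exists m, forall n : nat, (m <= n)%N -> 2 / n.+2%:R < t.
Proof.
move=> t0; exists (Num.bound (2 / t)) => n mn.
have /archi_boundP : 0 <= 2 / t by rewrite divr_ge0 // ltW.
rewrite ltr_pdivrMr // => H; rewrite ltr_pdivrMr // mulrC.
apply: lt_le_trans H _; rewrite ler_wpM2r ?(ltW t0) // ler_nat.
by rewrite (leq_trans mn) // -addn2 leq_addr.
Qed.

Lemma sqrt_lim_ex k : rnorm k <= 1 ->
  exists p, forall n, rnorm (sqrt_iter k n - p) <= 2 / n.+2%:R.
Proof.
move=> k1.
have : cauchy (sqrt_iter k @ \oo).
  apply: cauchy_exP => e epos.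
  have e0 : 0 < complex.Re e by move: epos; rewrite ltcE => /andP[].
  have [m me] := harmonic_small e0.
  exists (sqrt_iter k m); exists m => // n /= mn.
  rewrite -ball_normE /ball_ /=.
  rewrite -(RRe_real (gtr0_real epos)) rnormE ltcR rnormBC.
  exact: le_lt_trans (sqrt_iter_cauchy k1 mn) (me _ _).
move=> /cauchy_cvgP /cvg_ex[p /cvgrPdist_lt pP]; exists p => n.
apply/ler_addgt0Pr => e e0.
have e0' : 0 < e%:C by rewrite ltcR.
have [m _ mP] := pP _ e0'.
rewrite -(subrKA (sqrt_iter k (maxn m n))); apply: le_trans (ler_rnormD _ _) _.
rewrite lerD //; first by rewrite rnormBC sqrt_iter_cauchy // leq_maxr.
have := mP (maxn m n) (leq_maxl _ _).
by rewrite /= rnormE ltcR rnormBC => /ltW.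
Qed.

(** The limit is chosen through its explicit rate, so that identities about it follow from norm
    estimates alone. The default 0 is taken only when no such limit exists, which is excluded for
    [|k| <= 1]. *)
Definition sqrt_lim k : A := xget 0 [set p | forall n, rnorm (sqrt_iter k n - p) <= 2 / n.+2%:R].

Lemma sqrt_limP k n : rnorm k <= 1 -> rnorm (sqrt_iter k n - sqrt_lim k) <= 2 / n.+2%:R.
Proof. by move=> /sqrt_lim_ex ex; apply: (xgetPex 0 ex). Qed.

(** Passage to the limit: an identity for [sqrt_lim] is proved by bounding the difference of its two
    sides by a multiple of the rate. *)
Lemma rnorm_small_eq0 x (c : R) : (forall n : nat, rnorm x <= c * (2 / n.+2%:R)) -> x = 0.
Proof.
move=> H; apply: rnorm_eq0; apply/eqP; rewrite eq_le rnorm_ge0 andbT leNgt.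
apply/negP => x0.
have c0 : 0 <= c.
  have := le_trans (rnorm_ge0 x) (H 0%N); rewrite divff ?mulr1 //.
  by rewrite pnatr_eq0.
have c1 : 0 < c + 1 by rewrite ltr_wpDl.
have [m /(_ m (leqnn m))] := harmonic_small (divr_gt0 x0 c1).
rewrite ltr_pdivlMr // => me; have := H m.
have : 0 <= 2 / m.+2%:R :> R by rewrite divr_ge0.
by move: me; move: (2 / _) => h; nra.
Qed.

Lemma rnorm_sqrt_lim k : rnorm k <= 1 -> rnorm (sqrt_lim k) <= 1.
Proof.
move=> k1; apply/ler_addgt0Pr => e e0.
have [m /(_ m (leqnn m)) me] := harmonic_small e0.
rewrite -[sqrt_lim k](subKr (sqrt_iter k m)); apply: le_trans (ler_rnormB _ _) _.
rewrite lerD //; last by apply: le_trans (sqrt_limP _ _) (ltW me).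
apply: le_trans (sqrt_iter_bound _ k1) _.
by have [/andP[]] := sqrt_iterR_bounds m.
Qed.

Lemma harmonic_leS n : 2 / n.+3%:R <= 2 / n.+2%:R :> R.
Proof. by rewrite ler_pM2l // lef_pV2 ?posrE // ler_nat. Qed.

(** On the closed unit ball [sqrt_step k] is 1-Lipschitz, the factor [1/2] absorbing
    [|x| + |y| <= 2]; both sides are compared with iterate [n.+1]. *)
Lemma sqrt_lim_fix k : rnorm k <= 1 -> sqrt_step k (sqrt_lim k) = sqrt_lim k.
Proof.
move=> k1; apply/eqP; rewrite -subr_eq0; apply/eqP; apply: (@rnorm_small_eq0 _ 2) => n.
rewrite -(subrKA (sqrt_iter k n.+1)).
apply: le_trans (ler_rnormD _ _) _; rewrite [leRHS]mulr_natl mulr2n lerD //; last first.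
  exact: le_trans (sqrt_limP _ k1) (harmonic_leS n).
rewrite /sqrt_iter iterS -/(sqrt_iter k n) /sqrt_step -scalerBr opprD addrACA subrr add0r.
rewrite rnormZr ger0_norm ?invr_ge0 // ler_pdivrMl //.
apply: le_trans (rnorm_sqr_diff _ _) _; rewrite rnormBC [leRHS]mulrC.
rewrite ler_pM ?rnorm_ge0 ?addr_ge0 ?rnorm_ge0 ?sqrt_limP //.
rewrite (natrD _ 1 1) lerD // ?rnorm_sqrt_lim //; apply: le_trans (sqrt_iter_bound _ k1) _.
by have [/andP[]] := sqrt_iterR_bounds n.
Qed.

Lemma sqrt_limE k : rnorm k <= 1 -> (1 - sqrt_lim k) * (1 - sqrt_lim k) = 1 - k.
Proof.
move=> /sqrt_lim_fix; set p := sqrt_lim k => pE.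
have : p + p = k + p * p.
  rewrite -{1 2}pE /sqrt_step -scalerDl -rmorphD /=.
  by have -> : 2^-1 + 2^-1 = 1 :> R; [lra|rewrite scale1r].
move=> ppE; have kE : k = p + p - p * p by rewrite ppE addrK.
rewrite [in RHS]kE mulrBr mulr1 mulrBl mul1r !opprB opprD -!addrA; congr (_ + _).
by rewrite addrCA.
Qed.

(** Each pair of iterates is intertwined by [z]. Two different elements [k] and [k'] are allowed
    because [y^*] will later intertwine elements built from [y y^*] and [y^* y]. *)
Lemma sqrt_lim_comm k k' z : rnorm k <= 1 -> rnorm k' <= 1 ->
  z * k = k' * z -> z * sqrt_lim k = sqrt_lim k' * z.
Proof.
move=> k1 k'1 zk; apply/eqP; rewrite -subr_eq0; apply/eqP.
apply: (@rnorm_small_eq0 _ (rnorm z * 2)) => n.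
have zn : z * sqrt_iter k n = sqrt_iter k' n * z.
  elim: n => [|n IHn]; first by rewrite /sqrt_iter /= mulr0 mul0r.
  rewrite /sqrt_iter !iterS -/(sqrt_iter k n) -/(sqrt_iter k' n) /sqrt_step.
  by rewrite -scalerAl -scalerAr mulrDr mulrDl zk mulrA IHn -mulrA IHn mulrA.
have -> : z * sqrt_lim k - sqrt_lim k' * z =
    (sqrt_iter k' n - sqrt_lim k') * z - z * (sqrt_iter k n - sqrt_lim k).
  by rewrite mulrBr mulrBl zn opprB [RHS]addrC subrKA.
apply: le_trans (ler_rnormB _ _) _; 
rewrite [rnorm z * 2]mulr_natr mulr2n [leRHS]mulrDl lerD //; apply: le_trans (rnormM _ _) _.
  by rewrite mulrC ler_wpM2l ?rnorm_ge0 ?sqrt_limP.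
by rewrite ler_wpM2l ?rnorm_ge0 ?sqrt_limP.
Qed.

Lemma sqrt_lim_sa k : rnorm k <= 1 -> star k = k -> star (sqrt_lim k) = sqrt_lim k.
Proof.
move=> k1 kE; apply/eqP; rewrite -subr_eq0; apply/eqP.
apply: (@rnorm_small_eq0 _ 2) => n.
have zn : star (sqrt_iter k n) = sqrt_iter k n.
  elim: n => [|n IHn]; first by rewrite /sqrt_iter /= star0.
  rewrite /sqrt_iter iterS -/(sqrt_iter k n) /sqrt_step.
  by rewrite starZr starD starM kE IHn.
rewrite -(subrKA (sqrt_iter k n)) -{1}zn -starB.
apply: le_trans (ler_rnormD _ _) _; rewrite rnorm_star rnormBC [leRHS]mulr_natl mulr2n.
by rewrite lerD // sqrt_limP.
Qed.

End SquareRoot.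

(** * Positive elements *)

Section Positive.
Context (R : realType) (A : cstarAlgType R).
Implicit Types (x y z h k s d : A) (t : R).

Lemma conj_i : Num.conj ('i%C : R[i]) = - 'i%C.
Proof. by rewrite conj_conjc; apply/eqP; rewrite eq_complex /= oppr0 !eqxx. Qed.

Lemma double_half x : (2^-1 : R)%:C *: (x + x) = x.
Proof.
rewrite scalerDr -scalerDl -rmorphD /=.
by have -> : 2^-1 + 2^-1 = 1 :> R; [lra|rewrite scale1r].
Qed.

Lemma rnorm_half x y t : rnorm x <= t -> rnorm y <= t ->
  rnorm ((2^-1 : R)%:C *: (x + y)) <= t.
Proof.
move=> xt yt; rewrite rnormZr ger0_norm ?invr_ge0 // ler_pdivrMl // mulr_natl mulr2n.
by apply: le_trans (ler_rnormD _ _) _; rewrite lerD.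
Qed.

(* [k + i s] is normal with real part [k]. *)
Lemma rnorm_comm_sqrD k s : star k = k -> star s = s -> k * s = s * k ->
  rnorm k ^+ 2 <= rnorm (k * k + s * s).
Proof.
move=> kE sE ks; pose U := k + 'i%C *: s.
have UE : star U = k - 'i%C *: s by rewrite starD kE cstarZ sE conj_i scaleNr.
have ii : 'i%C * 'i%C = -1 :> R[i] by rewrite -expr2 sqr_i.
have <- : star U * U = k * k + s * s.
  rewrite UE /U mulrDr !mulrBl -!scalerAl -!scalerAr ks scalerA ii scaleN1r.
  by rewrite opprK addrA subrK.
(* It remains to see [|k| <= |U|]: [k] is the mean of [U] and [U^*], which have the same norm. *)
rewrite rnorm_star_mul lerXn2r ?nnegrE ?rnorm_ge0 //.
rewrite -[k]double_half; have -> : k + k = U + star U.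
  by rewrite UE /U addrACA subrr addr0.
by rewrite rnorm_half // rnorm_star.
Qed.

Definition positive_elt h := star h = h /\ exists2 t, 0 <= t & rnorm (rscalar A t - h) <= t.

(** The scale may be enlarged at will, which lets two positive elements share one. *)
Lemma positive_elt_large h : positive_elt h ->
  exists2 t0, 0 <= t0 & forall t, t0 <= t -> rnorm (rscalar A t - h) <= t.
Proof.
move=> [_ [t0 t00 ht0]]; exists t0 => // t t0t.
have -> : rscalar A t - h = rscalar A (t - t0) + (rscalar A t0 - h) by rewrite rscalarB addrA subrK.
apply: le_trans (ler_rnormD _ _) _.
by rewrite rnorm_rscalar ger0_norm ?subr_ge0 // -[leRHS](subrK t0) lerD.
Qed.

Lemma positive_eltD h k : positive_elt h -> positive_elt k -> positive_elt (h + k).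
Proof.
move=> [hE [t t0 ht]] [kE [u u0 ku]]; split; first by rewrite starD hE kE.
exists (t + u); first by rewrite addr_ge0.
by rewrite rscalarD opprD addrACA; apply: le_trans (ler_rnormD _ _) _; rewrite lerD.
Qed.

Lemma positive_eltZ t h : 0 <= t -> positive_elt h -> positive_elt (t%:C *: h).
Proof.
move=> t0 [hE [u u0 hu]]; split; first by rewrite starZr hE.
exists (t * u); first by rewrite mulr_ge0.
by rewrite /rscalar rmorphM -scalerA -scalerBr rnormZr ger0_norm // ler_wpM2l.
Qed.

(** Dividing by the scale [t] puts [k = 1 - h / t] in the unit ball, where [1 - sqrt_lim k] is a
    root of [1 - k = h / t]. *)
Definition sqrt_elt t h : A := (Num.sqrt t)%:C *: (1 - sqrt_lim (1 - (t^-1)%:C *: h)).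

Lemma rnorm_sqrt_elt_arg t h : 0 < t -> rnorm (rscalar A t - h) <= t ->
  rnorm (1 - (t^-1)%:C *: h) <= 1.
Proof.
move=> t0 ht; have -> : 1 - (t^-1)%:C *: h = (t^-1)%:C *: (rscalar A t - h).
  by rewrite scalerBr /rscalar scalerA -rmorphM mulVf ?gt_eqF // scale1r.
by rewrite rnormZr gtr0_norm ?invr_gt0 // ler_pdivrMl // mulr1.
Qed.

Lemma sqrt_eltK t h : 0 < t -> rnorm (rscalar A t - h) <= t ->
  sqrt_elt t h * sqrt_elt t h = h.
Proof.
move=> t0 ht; rewrite /sqrt_elt -scalerAl -scalerAr scalerA -rmorphM -expr2 sqr_sqrtr ?ltW //.
rewrite sqrt_limE ?rnorm_sqrt_elt_arg // subKr scalerA -rmorphM mulfV ?gt_eqF //.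
exact: scale1r.
Qed.

Lemma sqrt_elt_ge0 t h : 0 < t -> rnorm (rscalar A t - h) <= t -> star h = h ->
  positive_elt (sqrt_elt t h).
Proof.
move=> t0 ht hE; have ? := rnorm_sqrt_elt_arg t0 ht; split.
  by rewrite starZr starB star1 sqrt_lim_sa // starB star1 starZr hE.
exists (Num.sqrt t); first exact: sqrtr_ge0.
rewrite /rscalar /sqrt_elt -scalerBr subKr rnormZr ger0_norm ?sqrtr_ge0 //.
by rewrite -[leRHS]mulr1 ler_wpM2l ?sqrtr_ge0 // rnorm_sqrt_lim.
Qed.

Lemma sqrt_elt_comm t h h' z : 0 < t ->
  rnorm (rscalar A t - h) <= t -> rnorm (rscalar A t - h') <= t ->
  z * h = h' * z -> z * sqrt_elt t h = sqrt_elt t h' * z.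
Proof.
move=> t0 ht ht' zh; rewrite /sqrt_elt -scalerAr -scalerAl; congr (_ *: _).
rewrite mulrBl mulrBr mulr1 mul1r; congr (_ - _).
apply: sqrt_lim_comm; rewrite ?rnorm_sqrt_elt_arg //.
by rewrite mulrBl mulrBr mulr1 mul1r -scalerAl -scalerAr zh.
Qed.

(* Both roots are taken with the same scale [t], so that an element intertwining
   [h] and [h'] also intertwines their roots. *)
Lemma positive_sqrt2 h h' : positive_elt h -> positive_elt h' ->
  exists r r', [/\ positive_elt r, positive_elt r', r * r = h, r' * r' = h' &
    [/\ forall z, z * h = h' * z -> z * r = r' * z,
        forall z, z * h = h * z -> z * r = r * z
      & forall z, z * h' = h' * z -> z * r' = r' * z]].
Proof.
move=> ph ph'; have [hE _] := ph; have [hE' _] := ph'.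
have [t t0 ht] := positive_elt_large ph; have [t' t'0 ht'] := positive_elt_large ph'.
pose u := t + t' + 1; have u0 : 0 < u by rewrite /u; lra.
have hu : rnorm (rscalar A u - h) <= u by apply: ht; rewrite /u; lra.
have hu' : rnorm (rscalar A u - h') <= u by apply: ht'; rewrite /u; lra.
exists (sqrt_elt u h), (sqrt_elt u h'); split.
- exact: sqrt_elt_ge0.
- exact: sqrt_elt_ge0.
- exact: sqrt_eltK.
- exact: sqrt_eltK.
- by split=> z zh; apply: sqrt_elt_comm.
Qed.

Lemma positive_sqrt h : positive_elt h -> exists r, [/\ positive_elt r, r * r = h &
  forall z, z * h = h * z -> z * r = r * z].
Proof. by move=> ph; have [r [_ [? _ ? _ [_ ? _]]]] := positive_sqrt2 ph ph; exists r. Qed.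

(** After rescaling to [k' ^2 = h] with [|h| <= 1], the root [s] of [1 - h] commutes with [k'], and
    [|1 - h| = |s|^2 <= |s^2 + k' ^2| = 1]. *)
Lemma positive_sqr k : star k = k -> positive_elt (k * k).
Proof.
move=> kE; split; first by rewrite starM kE.
(* The added 1 keeps the scale invertible when [k = 0]. *)
pose T := rnorm k ^+ 2 + 1.
have T0 : 0 < T by rewrite /T ltr_wpDl // sqr_ge0.
exists T; first exact: ltW.
pose h := (T^-1)%:C *: (k * k).
have hE : star h = h by rewrite starZr starM kE.
have h1 : rnorm h <= 1.
  rewrite rnormZr gtr0_norm ?invr_gt0 // ler_pdivrMl // mulr1 rnorm_sqr_sa //.
  by rewrite /T lerDl.
have phc : positive_elt (1 - h).
  split; first by rewrite starB star1 hE.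
  by exists 1 => //; rewrite rscalar1 subKr.
have [s [[sE _] ss sc]] := positive_sqrt phc.
have kh : k * (1 - h) = (1 - h) * k.
  by rewrite mulrBl mulrBr mulr1 mul1r -scalerAl -scalerAr mulrA.
have -> : rscalar A T - k * k = T%:C *: (s * s).
  by rewrite ss scalerBr scalerA -rmorphM mulfV ?gt_eqF // scale1r.
rewrite rnormZr gtr0_norm // -[leRHS]mulr1 ler_pM2l // rnorm_sqr_sa //.
pose k' := (Num.sqrt T^-1)%:C *: k.
have k'k' : k' * k' = h.
  by rewrite -scalerAl -scalerAr scalerA -rmorphM -expr2 sqr_sqrtr // invr_ge0 ltW.
have kcs : k * s = s * k by exact: sc.
have k'E : star k' = k' by rewrite starZr kE.
have sk' : s * k' = k' * s by rewrite -scalerAl -scalerAr kcs.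
apply: le_trans (rnorm_comm_sqrD sE k'E sk') _.
by rewrite ss k'k' subrK rnorm1.
Qed.

(** With commuting roots [k] of [a] and [s] of [t - a], [|a| = |k|^2 <= |k^2 + s^2| = t]. *)
Lemma positive_rnorm_le a t : 0 <= t -> positive_elt a ->
  positive_elt (rscalar A t - a) -> rnorm a <= t.
Proof.
move=> t0 pa pta; have [k [[kE _] kk kc]] := positive_sqrt pa.
have [s [[sE _] ss sc]] := positive_sqrt pta.
rewrite -kk rnorm_sqr_sa //; apply: le_trans (rnorm_comm_sqrD kE sE _) _.
  apply: sc; rewrite mulrBr mulrBl mul_rscalarl mul_rscalarr -kk.
  by rewrite mulrA.
by rewrite kk ss addrC subrK rnorm_rscalar ger0_norm.
Qed.

Lemma rscalarB_positive h t : star h = h -> rnorm h <= t -> positive_elt (rscalar A t - h).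
Proof.
move=> hE ht; split; first by rewrite starB star_rscalar hE.
by exists t; rewrite ?subKr // (le_trans (rnorm_ge0 h)).
Qed.

Lemma positive_antisym a : positive_elt a -> positive_elt (- a) -> a = 0.
Proof.
move=> pa pNa; apply: rnorm_eq0; apply/eqP; rewrite eq_le rnorm_ge0 andbT.
by apply: positive_rnorm_le; rewrite // rscalar0 sub0r.
Qed.

(** By commutation [d s d] is the square of the self-adjoint element [d r], where [r] is the root of
    [s]. *)
Lemma positive_conj s d : positive_elt s -> star d = d -> d * s = s * d ->
  positive_elt (d * s * d).
Proof.
move=> ps dE ds; have [r [[rE _] rr rc]] := positive_sqrt ps.
have dr := rc _ ds.
have -> : d * s * d = (d * r) * (d * r) by rewrite {2}dr -rr !mulrA.
by apply: positive_sqr; rewrite starM rE dE dr.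
Qed.

Lemma sa_sqr_eq0 d : star d = d -> d * d = 0 -> d = 0.
Proof.
move=> dE dd; apply: rnorm_eq0; apply/eqP.
by rewrite -sqrf_eq0 -rnorm_sqr_sa // dd rnorm0.
Qed.

Lemma sa_pow4_eq0 d : star d = d -> d * d * (d * d) = 0 -> d = 0.
Proof.
move=> dE d4; apply: (sa_sqr_eq0 dE); apply: sa_sqr_eq0 d4.
by rewrite starM dE.
Qed.

(** For [d = s - b], the positive elements [d s d] and [d b d] add up to [d (s^2 - b^2) = 0], so
    both vanish, and [d^4 = d (d s d - d b d) = 0]. *)
Lemma positive_sqrt_unique s b : positive_elt s -> positive_elt b ->
  s * b = b * s -> s * s = b * b -> s = b.
Proof.
move=> ps pb sb ss; have [sE _] := ps; have [bE _] := pb.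
apply/eqP; rewrite -subr_eq0; apply/eqP; set d := s - b.
have dE : star d = d by rewrite starB sE bE.
have psd : positive_elt (d * s * d).
  by apply: positive_conj; rewrite // /d mulrBl mulrBr sb.
have pbd : positive_elt (d * b * d).
  by apply: positive_conj; rewrite // /d mulrBl mulrBr sb.
have sum0 : d * s * d + d * b * d = 0.
  rewrite -mulrDl -mulrDr /d mulrDr !mulrBl ss sb.
  by rewrite addrC subrKA subrr mul0r.
have dsd : d * s * d = 0.
  apply: positive_antisym => //.
  by have -> : - (d * s * d) = d * b * d by apply/eqP; rewrite eqr_oppLR -addr_eq0 sum0.
have dbd : d * b * d = 0 by rewrite dsd add0r in sum0.
apply: sa_pow4_eq0 => //.
have -> : d * d * (d * d) = d * (d * s * d - d * b * d).
  by rewrite -mulrBl -mulrBr -/d !mulrA.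
by rewrite dsd dbd subrr mulr0.
Qed.

(* [s] plays the role of [|h|], and [s - h] of twice the negative part of [h]. *)
Lemma positive_abs h s : star h = h -> positive_elt s -> s * s = h * h ->
  h * s = s * h -> s * (s - h) * (s * (s - h)) = 0 -> positive_elt h.
Proof.
move=> hE ps ss hs smsm; have [sE _] := ps.
suff /eqP : s - h = 0 by rewrite subr_eq0 => /eqP <-.
have mE : star (s - h) = s - h by rewrite starB sE hE.
apply: sa_pow4_eq0 => //.
have -> : (s - h) * (s - h) = s * (s - h) + s * (s - h).
  by rewrite {1}mulrBl; congr (_ + _); rewrite !mulrBr hs ss opprB.
by move: smsm; move: (s * (s - h)) => X XX; rewrite mulrDl !mulrDr XX !addr0.
Qed.

(* Stands in for the equality of the nonzero spectra of [y^* y] and [y y^*]: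
   [y^*] intertwines [|g|] and [|b| = b], hence kills [|g| - g]. *)
Lemma opp_star_mulC_positive y :
  positive_elt (- (star y * y)) -> positive_elt (- (y * star y)).
Proof.
set b := - (star y * y); set g := - (y * star y) => pb.
have [bE _] := pb; have gE : star g = g by rewrite starN starM starK.
have yg : star y * g = b * star y by rewrite mulrN mulNr mulrA.
have [s [sb [ps psb ss sbsb [c1 c2 c3]]]] := positive_sqrt2 (positive_sqr gE) (positive_sqr bE).
have sbE : sb = b.
  by apply: positive_sqrt_unique => //; apply/esym/c3; rewrite mulrA.
have ys : star y * s = b * star y.
  by rewrite -[in RHS]sbE; apply: c1; rewrite mulrA yg -!mulrA yg.
have gs : g * s = s * g by apply: c2; rewrite mulrA.
have ym : star y * (s - g) = 0 by rewrite mulrBr ys yg subrr.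
have gm : g * (s - g) = 0 by rewrite mulNr -mulrA ym mulr0 oppr0.
apply: (positive_abs gE ps ss gs).
have {1}-> : s * (s - g) = (s - g) * s by rewrite mulrBl mulrBr gs.
by rewrite -mulrA [s * (s * _)]mulrA ss -[g * g * _]mulrA gm !mulr0.
Qed.

(** Up to sign, [c] and [e] are twice the real and imaginary parts of [y]. Then
    [y^* y = (c^2 + e^2) / 2 - y y^*] is a sum of positive elements, so [y^* y] and its opposite are
    both positive. *)
Lemma opp_star_mul_positive y : positive_elt (- (star y * y)) -> star y * y = 0.
Proof.
move=> p1; have p2 := opp_star_mulC_positive p1.
apply: positive_antisym => //.
pose c := y + star y; pose e := 'i%C *: (y - star y).
have cE : star c = c by rewrite starD starK addrC.
have eE : star e = e by rewrite cstarZ conj_i starB starK scaleNr -scalerN opprB.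
have -> : star y * y = (2^-1 : R)%:C *: (c * c + e * e) + - (y * star y).
  have ii : 'i%C * 'i%C = -1 :> R[i] by rewrite -expr2 sqr_i.
  have -> : c * c + e * e = (star y * y + y * star y) + (star y * y + y * star y).
    rewrite /e -scalerAl -scalerAr scalerA ii scaleN1r /c.
    rewrite mulrBr !mulrBl !mulrDr !mulrDl !opprB.
    move: (y * y) (star y * star y) (star y * y) (y * star y) => u v p q.
    rewrite [u + p]addrC [q - v + _]addrC addrACA [p + u + _]addrACA subrr addr0.
    by rewrite [q + v + _]addrACA subrr addr0 addrACA.
  by rewrite double_half addrK.
apply: positive_eltD => //; apply: positive_eltZ; first by rewrite invr_ge0.
by apply: positive_eltD; apply: positive_sqr.
Qed.

(* With [h = x^* x] and [m = |h| - h], [(x m)^* (x m) = - m |h| m] is negative. *)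
Lemma star_mul_positive x : positive_elt (star x * x).
Proof.
set h := star x * x; have hE : star h = h by rewrite starM starK.
have [s [ps ss sc]] := positive_sqrt (positive_sqr hE).
have hs : h * s = s * h by apply: sc; rewrite mulrA.
have [sE _] := ps.
apply: (positive_abs hE ps ss hs); set m := s - h.
have mE : star m = m by rewrite starB sE hE.
have sm : m * s = s * m by rewrite /m mulrBl mulrBr hs.
have hm : h * m = - (s * m) by rewrite /m !mulrBr opprB hs ss.
have xmE : star (x * m) * (x * m) = - (m * s * m).
  by rewrite starM mE -mulrA [star x * _]mulrA -/h hm mulrN mulrA.
have : m * s * m = 0.
  apply/eqP; rewrite -oppr_eq0 -xmE; apply/eqP/opp_star_mul_positive.
  by rewrite xmE opprK; apply: positive_conj.
by move=> msm; rewrite -mulrA [m * _]mulrA msm mulr0.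
Qed.

End Positive.

(** * The Hahn-Banach theorem *)

Section HahnBanach.
Context (R : realType) (V : lmodType R).
Implicit Types (p q : V -> R) (x y e : V).

(** An inequality is enough for homogeneity: [sublinearZ] recovers equality by scaling back with the
    inverse. *)
Definition sublinear p :=
  (forall x y, p (x + y) <= p x + p y) /\
  (forall t x, 0 <= t -> p (t *: x) <= t * p x).

Lemma sublinear_ge p x : sublinear p -> - p (- x) <= p x.
Proof.
move=> [pD pZ]; have := pD 0 0; rewrite addr0 => p0; have := pD x (- x).
by rewrite subrr; lra.
Qed.

Lemma sublinear_inf (I : Type) (C : set I) (q : I -> V -> R) p :
  C !=set0 ->
  (forall i x, C i -> - p (- x) <= q i x) ->
  (forall i j x y, C i -> C j -> exists2 k, C k & q k (x + y) <= q i x + q j y) ->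
  (forall i t x, C i -> 0 < t -> exists2 k, C k & q k (t *: x) <= t * q i x) ->
  (exists2 k, C k & q k 0 <= 0) ->
  sublinear (fun x => inf [set q i x | i in C]).
Proof.
move=> C0 lb CD CZ C00.
have has_lb x : has_lbound [set q i x | i in C].
  by exists (- p (- x)) => _ [i Ci <-]; exact: lb.
have le_inf i x : C i -> inf [set q i x | i in C] <= q i x.
  by move=> Ci; apply: ge_inf => //; exists i.
have ge z x : (forall i, C i -> z <= q i x) -> z <= inf [set q i x | i in C].
  move=> H; apply: lb_le_inf; last by move=> _ [i Ci <-]; exact: H.
  by case: C0 => i Ci; exists (q i x), i.
split=> [x y|t x].
  set z := inf [set q i (x + y) | i in C].
  suff H i : C i -> z - q i x <= inf [set q i y | i in C].
    have : z - inf [set q i y | i in C] <= inf [set q i x | i in C].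
      by apply: ge => i Ci; have := H i Ci; lra.
    by lra.
  move=> Ci; apply: ge => j Cj; have [k Ck kij] := CD i j x y Ci Cj.
  by have := le_trans (le_inf k _ Ck) kij; rewrite -/z; lra.
rewrite le_eqVlt => /orP[/eqP <-|t0].
  rewrite scale0r mul0r; have [k Ck k0] := C00.
  exact: le_trans (le_inf k _ Ck) k0.
rewrite -ler_pdivrMl //; apply: ge => i Ci; rewrite ler_pdivrMl //.
have [k Ck kt] := CZ i t x Ci t0.
exact: le_trans (le_inf k _ Ck) kt.
Qed.

(** A sublinear minorant of [p] whose value at [- e] is at most [- p e], as [t = 1] shows. *)
Definition lower_along p e x := inf [set p (x + t *: e) - t * p e | t in [set t | 0 <= t]].

Lemma sublinearZ p t x : sublinear p -> 0 <= t -> p (t *: x) = t * p x.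
Proof.
move=> [pD pZ] t0; apply/eqP; rewrite eq_le pZ //= .
have [->|tn0] := eqVneq t 0.
  by rewrite mul0r scale0r; have := pD 0 0; rewrite addr0; lra.
have {tn0}t0 : 0 < t by rewrite lt_def tn0.
rewrite -ler_pdivlMl //; apply: le_trans (pZ _ _ _); last by rewrite invr_ge0 ltW.
by rewrite scalerA mulVf ?gt_eqF // scale1r.
Qed.

Lemma lower_along_lb p e x t : sublinear p -> 0 <= t ->
  - p (- x) <= p (x + t *: e) - t * p e.
Proof.
move=> sp t0; have [pD pZ] := sp; have := pD (x + t *: e) (- x).
by rewrite [x + _]addrC addrK (sublinearZ _ sp) //; lra.
Qed.

Lemma lower_along_sublinear p e : sublinear p -> sublinear (lower_along p e).
Proof.
move=> sp; have [pD pZ] := sp.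
apply: (@sublinear_inf _ [set t : R | 0 <= t] (fun t x => p (x + t *: e) - t * p e) p).
- by exists 0 => /=.
- by move=> t x /= t0; exact: lower_along_lb.
- move=> s t x y /= s0 t0; exists (s + t); first by rewrite /= addr_ge0.
  by rewrite scalerDl addrACA mulrDl; have := pD (x + s *: e) (y + t *: e); lra.
- move=> s t x /= s0 t0; exists (t * s); first by rewrite /= mulr_ge0 // ltW.
  by rewrite -scalerA -scalerDr (sublinearZ _ sp) ?(ltW t0) //= mulrBr mulrA.
- by exists 0 => //=; rewrite scale0r addr0 -(scale0r 0) (sublinearZ _ sp) //; lra.
Qed.

Lemma lower_along_le p e x t : sublinear p -> 0 <= t ->
  lower_along p e x <= p (x + t *: e) - t * p e.
Proof.
move=> sp t0; apply: ge_inf; last by exists t.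
by exists (- p (- x)) => _ [s s0 <-]; exact: lower_along_lb.
Qed.

Lemma minimal_sublinear p : sublinear p -> exists2 q, sublinear q /\ (forall x, q x <= p x) &
  forall q', sublinear q' -> (forall x, q' x <= q x) -> q' = q.
Proof.
move=> sp; pose T := {q | sublinear q /\ forall x, q x <= p x}.
(* The order is reversed, so that a maximal element for Zorn's lemma is a minimal functional. *)
pose le (q q' : T) := `[< forall x, sval q' x <= sval q x >].
have t0 : T by exists p.
have [||||q qmin] := @Zorn T le.
- by move=> q; apply/asboolP.
- move=> q r s /asboolP qr /asboolP rs; apply/asboolP => x.
  exact: le_trans (rs x) (qr x).
- move=> [q sq] [r sr] /asboolP qr /asboolP rq; apply: eq_exist => /=.
  by apply: funext => x; apply/eqP; rewrite eq_le qr rq.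
- move=> C totC; have [C0|C0] := pselect (C !=set0); last first.
    by exists t0 => s Cs; case: C0; exists s.
  have lbC (q : T) x : C q -> - p (- x) <= sval q x.
    move=> Cq; case: q Cq => q [sq qp] /= _.
    by apply: le_trans (sublinear_ge x sq); rewrite lerN2.
  have sC : sublinear (fun x => inf [set sval i x | i in C]).
    apply: (@sublinear_inf T C (fun i => sval i) p C0 (fun i x => @lbC i x)).
    + move=> q r x y Cq Cr.
      have [/asboolP qr|/asboolP rq] := totC _ _ Cq Cr.
        exists r => //; apply: le_trans (_ : sval r x + sval r y <= _).
          by case: (r) => r' [[]].
        by rewrite lerD.
      exists q => //; apply: le_trans (_ : sval q x + sval q y <= _).
        by case: (q) => r' [[]].
      by rewrite lerD.
    + move=> q t x Cq t1; exists q => //; case: (q) => r' [[? H] ?] /=.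
      by rewrite H // ltW.
    + case: C0 => q Cq; exists q => //; case: (q) => r' [[? H] ?] /=.
      by have := H 0 0 (lexx 0); rewrite scale0r mul0r.
  have lb (q : T) x : C q -> inf [set sval i x | i in C] <= sval q x.
    move=> Cq; apply: ge_inf; last by exists q.
    by exists (- p (- x)) => _ [r Cr <-]; exact: lbC.
  have Cp x : inf [set sval i x | i in C] <= p x.
    case: C0 => q Cq; apply: le_trans (lb q x Cq) _.
    by case: (q) => r' [].
  exists (exist (fun r => sublinear r /\ forall x, r x <= p x) _ (conj sC Cp)) => i Ci.
  by apply/asboolP => x /=; exact: lb.
exists (sval q); first by case: (q).
move=> q' sq' q'q.
have q'p x : q' x <= p x by apply: le_trans (q'q x) _; case: (q) => r' [].
have <- // := qmin (exist (fun r => sublinear r /\ forall x, r x <= p x) q' (conj sq' q'p)).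
exact/asboolP.
Qed.

(* A minimal sublinear functional is linear, since lowering it along a direction
   leaves it unchanged. *)
Lemma hahn_banach p e : sublinear p ->
  exists f : V -> R, [/\ forall x y, f (x + y) = f x + f y,
    forall t x, f (t *: x) = t * f x, forall x, f x <= p x & f e = p e].
Proof.
(* Minimizing below [lower_along p e] instead of [p] forces [q (- e) <= - p e], hence [q e = p e]
   once [q] is odd. *)
move=> sp; have [q [sq qp] qmin] := minimal_sublinear (lower_along_sublinear e sp).
have [qD _] := sq.
have q0 : q 0 = 0 by rewrite -(scale0r 0) (sublinearZ _ sq) // mul0r.
have qN x : q (- x) = - q x.
  apply/eqP; rewrite eq_le; apply/andP; split; last first.
    by have := sublinear_ge x sq; lra.
  have lq : lower_along q x = q.
    apply: qmin => [|y]; first exact: lower_along_sublinear.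
    have := lower_along_le x y sq (lexx 0).
    by rewrite scale0r addr0 mul0r subr0.
  have := lower_along_le x (- x) sq ler01.
  by rewrite lq scale1r addNr q0; lra.
have qle x : q x <= p x.
  apply: le_trans (qp x) _; have := lower_along_le e x sp (lexx 0).
  by rewrite scale0r addr0 mul0r subr0.
exists q; split=> //.
- move=> x y; apply/eqP; rewrite eq_le qD /=.
  by have := qD (- x) (- y); rewrite -opprD !qN; lra.
- move=> t x; have [t0|/ltW t0] := leP 0 t; first exact: sublinearZ.
  have -> : t *: x = - (- t *: x) by rewrite scaleNr opprK.
  by rewrite qN (sublinearZ _ sq) ?oppr_ge0 // mulNr opprK.
- apply/eqP; rewrite eq_le qle /=.
  have := le_trans (qp (- e)) (lower_along_le e (- e) sp ler01).
  rewrite qN scale1r addNr mul1r -(scale0r 0) (sublinearZ _ sp) // mul0r.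
  by lra.
Qed.

End HahnBanach.

(** * States *)

(** Restriction of scalars to [R], under a separate name that carries the real module structure
    needed for the Hahn-Banach theorem. *)
Definition real_module (R : realType) (V : lmodType R[i]) : Type := V.

Section RealModule.
Context (R : realType) (V : lmodType R[i]).

HB.instance Definition _ := GRing.Zmodule.on (real_module V).

Let rscale (t : R) (x : real_module V) : real_module V := t%:C *: (x : V).

Fact rscaleA t u x : rscale t (rscale u x) = rscale (t * u) x.
Proof. by rewrite /rscale scalerA rmorphM. Qed.

Fact rscale1 : left_id 1 rscale.
Proof. by move=> x; rewrite /rscale scale1r. Qed.

Fact rscaleDr : right_distributive rscale +%R.
Proof. by move=> t x y; rewrite /rscale scalerDr. Qed.

Fact rscaleDl x : {morph rscale^~ x : t u / t + u}.
Proof. by move=> t u; rewrite /rscale rmorphD scalerDl. Qed.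

HB.instance Definition _ := GRing.Zmodule_isLmodule.Build R (real_module V)
  rscaleA rscale1 rscaleDr rscaleDl.

End RealModule.

Section States.
Context (R : realType) (A : cstarAlgType R).
Implicit Types (x y u v a b h : A) (f : {linear A -> R[i]^o}).

Lemma positive_functional_elt f h : positive_functional f -> positive_elt h ->
  0 <= (f h : R[i]).
Proof.
move=> pf /positive_sqrt[r [[rE _] rr _]].
by have := pf r; rewrite rE rr.
Qed.

Lemma positive_functional_star f x : positive_functional f ->
  f (star x) = Num.conj (f x : R[i]).
Proof.
move=> pf.
have im1 : complex.Im (f 1) = 0.
  by have := pf 1; rewrite star1 mulr1 => /ger0_Im.
have saIm h : star h = h -> complex.Im (f h) = 0.
  move=> hE; have := positive_functional_elt pf (rscalarB_positive hE (lexx _)).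
  move/ger0_Im; rewrite linearB /= linearZ /=.
  move: im1; case: (f 1) (f h) => [c d] [c' d'] /= ->.
  by rewrite mulr0 mul0r addr0 sub0r => /eqP; rewrite oppr_eq0 => /eqP.
have h1 : complex.Im (f (x + star x)) = 0 by apply: saIm; rewrite starD starK addrC.
have h2 : complex.Im (f ('i%C *: (x - star x))) = 0.
  by apply: saIm; rewrite cstarZ conj_i starB starK scaleNr -scalerN opprB.
move: h1 h2; rewrite conj_conjc linearD linearZ linearB /=.
case: (f x) (f (star x)) => [c d] [c' d'] /= /eqP; rewrite addr_eq0 => /eqP ->.
rewrite mul0r mul1r add0r => /eqP; rewrite subr_eq0 => /eqP ->.
by rewrite opprK.
Qed.

Lemma positive_functional_CS f u v : positive_functional f ->
  rnorm (f (star u * v)) ^+ 2 <=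
  complex.Re (f (star u * u)) * complex.Re (f (star v * v)).
Proof.
move=> pf.
pose C := complex.Re (f (star u * u)); pose D := complex.Re (f (star v * v)).
pose M := rnorm (f (star u * v)) ^+ 2.
have ReP x : 0 <= complex.Re (f (star x * x)).
  by have := pf x; rewrite lecE => /andP[].
have C0 : 0 <= C := ReP u.
have D0 : 0 <= D := ReP v.
have M0 : 0 <= M by rewrite sqr_ge0.
(* Positivity of [f] at [v - t beta u] with [beta = f (u^* v)], a real quadratic in [t]. *)
have quad t : 0 <= t * t * M * C - 2 * t * M + D.
  pose beta : R[i] := f (star u * v).
  pose c : R[i] := - (t%:C * beta).
  have H := ReP (c *: u + v).
  have fE : f (star (c *: u + v) * (c *: u + v)) = Num.conj c * (c * f (star u * u))
      + c * Num.conj beta + (Num.conj c * beta + f (star v * v)) :> R[i].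
    rewrite starD cstarZ mulrDr !mulrDl -!scalerAl -!scalerAr !linearD !linearZ /=.
    have -> : f (star v * u) = Num.conj beta.
      by rewrite -(positive_functional_star _ pf) starM starK.
    by rewrite !linearZ.
  rewrite {}fE in H.
  have Mr : M = complex.Re (beta * Num.conj beta).
    by rewrite -normCK (rnormE (f (star u * v))) -rmorphXn.
  have im0 := ger0_Im (pf u).
  rewrite /C /D Mr; move: H; rewrite /c !conj_conjc.
  move: im0; clear Mr c.
  move: beta (f (star u * u)) (f (star v * v)) => [b1 b2] [c1 c2] [d1 d2] /= ->.
  set X := (X in 0 <= X -> _); set Y := (X in _ -> 0 <= X).
  suff -> : X = Y by [].
  by rewrite /X /Y; ring.
rewrite -/M -/C -/D; clearbody M C D.
have [CC|Cn] := eqVneq C 0.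
  have [->|Mn] := eqVneq M 0; first by rewrite mulr_ge0.
  (* When [C = 0] the quadratic is affine, and this [t] would make it equal to [- D - 2 < 0]. *)
  have := quad ((D + 1) / M); rewrite CC mulr0 sub0r -!mulrA mulVf //; lra.
have := quad C^-1.
have Cp : 0 < C by rewrite lt_def Cn.
move=> H; have : 0 <= C * (C^-1 * C^-1 * M * C - 2 * C^-1 * M + D) by rewrite mulr_ge0.
have -> : C * (C^-1 * C^-1 * M * C - 2 * C^-1 * M + D) = C * D - M by field.
by rewrite subr_ge0.
Qed.

Lemma positive_functional_sqr_le f x : positive_functional f -> f 1 = 1 ->
  complex.Re (f (star x * x)) <= rnorm x ^+ 2.
Proof.
move=> pf f1; have hE : star (star x * x) = star x * x by rewrite starM starK.
have := positive_functional_elt pf (rscalarB_positive hE (lexx _)).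
rewrite linearB linearZ /= f1 rnorm_star_mul lecE => /andP[_] /=.
by case: (f _) => c d /=; rewrite mulr1 mul0r subr0 subr_ge0.
Qed.

Lemma positive_functional_contract f x : positive_functional f -> f 1 = 1 ->
  rnorm (f x) <= rnorm x.
Proof.
move=> pf f1; have := positive_functional_CS 1 x pf.
rewrite star1 !mul1r f1 /= mul1r => H.
rewrite -(ler_pXn2r (ltn0Sn 1)) ?nnegrE ?rnorm_ge0 //.
exact: le_trans H (positive_functional_sqr_le _ pf f1).
Qed.

(** Contractivity supplies continuity and bounds the functional norm by 1; the value at the unit
    attains it. *)
Lemma state_spaceP f : state_space f <-> positive_functional f /\ f 1 = 1.
Proof.
split=> [[]//|[pf f1]]; split=> //.
  move=> x; apply/cvgrPdist_lt => e e0; near=> y.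
  rewrite -linearB (rnormE (f (x - y))).
  apply: le_lt_trans (_ : (rnorm (x - y))%:C < e).
    by rewrite lecR positive_functional_contract.
  rewrite -rnormE; near: y.
  by have /cvgrPdist_lt := @cvg_id _ (nbhs x); apply.
apply/eqP; rewrite eq_le; apply/andP; split.
  apply: ge_sup; first by exists (rnorm (f 0)), 0 => //=; rewrite rnorm0.
  move=> _ [x /= x1 <-]; apply: le_trans x1.
  exact: positive_functional_contract.
apply: ub_le_sup.
  exists 1 => _ [x /= x1 <-]; apply: le_trans x1.
  exact: positive_functional_contract.
exists 1 => /=; first by rewrite rnorm1.
by rewrite f1; apply: rnorm_eq; rewrite normr1.
Unshelve. all: by end_near.
Qed.

Lemma linear_ex (F : A -> R[i]^o) : linear F -> exists f, forall x, f x = F x.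
Proof.
move=> lF.
pose mF := GRing.isLinear.Build R[i] A R[i]^o *:%R F lF.
by exists (HB.pack F mF : {linear A -> R[i]^o}).
Qed.

(** For [t = |1 + b|] the element [(t - 1) - b] is positive, and so is [t - 1] after adding [b];
    monotonicity of the norm then gives [|b| <= t - 1]. *)
Lemma rnorm1D b : positive_elt b -> rnorm (1 + b) = 1 + rnorm b.
Proof.
move=> pb; have [bE _] := pb.
apply/eqP; rewrite eq_le -{1}(rnorm1 A) ler_rnormD /=.
have p1 : positive_elt (1 : A) by have := positive_sqr (star1 A); rewrite mulr1.
set t := rnorm (1 + b).
have pt : positive_elt (rscalar A t - (1 + b)).
  by apply: rscalarB_positive => //; rewrite starD star1 bE.
have t1 : 1 <= t.
  rewrite -(rnorm1 A); apply: positive_rnorm_le; rewrite ?rnorm_ge0 //.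
  have -> : rscalar A t - 1 = (rscalar A t - (1 + b)) + b by rewrite opprD addrA subrK.
  exact: positive_eltD.
rewrite -lerBrDl; apply: positive_rnorm_le; rewrite ?subr_ge0 //.
by rewrite rscalarB rscalar1 -addrA -opprD.
Qed.

Lemma state_norming b : positive_elt b ->
  exists2 f, state_space f & f b = (rnorm b)%:C.
Proof.
move=> pb; have [bE _] := pb.
(* Discarding the imaginary part in [p] makes [phi] vanish on [i h] for [h]
   self-adjoint. *)
pose p (x : real_module A) := rnorm ((2^-1 : R)%:C *: (x + star x) : A).
have psa h : star h = h -> p h = rnorm h by move=> hE; rewrite /p hE double_half.
have sp : sublinear p.
  split=> [x y|t x t0].
    by rewrite /p starD addrACA scalerDr ler_rnormD.
  have -> : t *: x = t%:C *: (x : A) by [].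
  by rewrite /p starZr -scalerDr !rnormZr (ger0_norm t0) mulrCA.
(* Norming [1 + b] forces both [phi 1 = 1] and [phi b = `|b|]. *)
have [phi [phiD phiZ phip phie]] := hahn_banach (1 + b : real_module A) sp.
have phiB (x y : A) : phi (x - y) = phi x - phi y.
  by have := phiD (x - y) y; rewrite subrK => ->; rewrite addrK.
have phi1b : phi 1 = 1 /\ phi b = rnorm b.
  have : phi 1 + phi b = 1 + rnorm b.
    by rewrite -phiD phie psa ?rnorm1D // starD star1 bE.
  have := phip 1; rewrite psa ?star1 // rnorm1.
  have := phip b; rewrite psa //; lra.
have phiZC (t : R) (x : A) : phi (t%:C *: x) = t * phi x by exact: (phiZ t x).
have phi0 : phi 0 = 0 by rewrite -(subrr (1 : A)) phiB subrr.
(* If [|t - h| <= t], then [t - phi h = phi (t - h) <= t]. *)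
have phi_pos (h : A) : positive_elt h -> 0 <= phi h.
  move=> [hE [t t0 ht]].
  have := phip (rscalar A t - h); rewrite phiB phiZC phi1b.1 mulr1 psa.
    by move: ht; lra.
  by rewrite starB star_rscalar hE.
have phi_i (h : A) : star h = h -> phi ('i%C *: h) = 0.
  move=> hE; have pi0 (c : R[i]) : Num.conj c = - c -> p (c *: h) = 0.
    by move=> cE; rewrite /p cstarZ hE cE scaleNr subrr scaler0 rnorm0.
  have l1 := phip ('i%C *: h : A); rewrite pi0 ?conj_i // in l1.
  have l2 := phip ((- 'i%C) *: h : A).
  rewrite pi0 in l2; last by rewrite rmorphN /= conj_i.
  have := phiB 0 ('i%C *: h); rewrite sub0r -scaleNr phi0; lra.
(* The usual complexification of a real functional. *)
pose F (x : A) : R[i]^o := phi x -i* phi ('i%C *: x).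
have lF : linear F.
  move=> [c d] x y; rewrite /F scalerDr !phiD.
  have cd z : (c +i* d) *: z = c%:C *: z + d%:C *: ('i%C *: z).
    by rewrite scalerA -scalerDl; congr (_ *: _); simpc.
  have -> : 'i%C *: ((c +i* d) *: x) = c%:C *: ('i%C *: x) - d%:C *: x.
    by rewrite !scalerA -scaleNr -scalerDl; congr (_ *: _); simpc.
  rewrite cd phiD phiB !phiZC.
  by apply/eqP; rewrite eq_complex /=; apply/andP; split; apply/eqP; ring.
have [f fF] := linear_ex lF.
exists f; last first.
  by rewrite fF /F phi1b.2 phi_i // oppr0.
apply/state_spaceP; split.
  move=> x; rewrite fF /F phi_i; last by rewrite starM starK.
  by rewrite oppr0 lecE /= eqxx phi_pos //; exact: star_mul_positive.
by rewrite fF /F phi1b.1 phi_i ?star1 // oppr0.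
Qed.

End States.

(** * Maxima on the unit circle *)

Section CircleMax.
Context (R : realType).
Implicit Types (F : R[i] -> R) (l m : R[i]).

Lemma normc_le_ReIm (x y : R) : rnorm (x +i* y : R[i]^o) <= `|x| + `|y|.
Proof.
have -> : x +i* y = x%:C + y%:C * 'i%C :> R[i] by simpc.
apply: le_trans (ler_rnormD _ _) _; rewrite rnorm_real lerD //.
suff -> : rnorm (y%:C * 'i%C : R[i]^o) = `|y| by [].
by apply: rnorm_eq; rewrite normc_def; simpc; rewrite /= expr0n add0r sqrtr_sqr.
Qed.

(** A half circle is parametrized by the real part, with [e = 1] or [e = -1] selecting the upper or
    lower one; the extreme value theorem on [[-1, 1]] then applies. *)
Lemma arc_max F (e : R) : (forall l m, `|F l - F m| <= rnorm (l - m : R[i]^o)) ->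
  exists2 c : R, -1 <= c <= 1 & forall t, -1 <= t <= 1 ->
    F (t +i* (e * Num.sqrt (1 - t ^+ 2))) <= F (c +i* (e * Num.sqrt (1 - c ^+ 2))).
Proof.
move=> lipF; pose g (t : R) := e * Num.sqrt (1 - t ^+ 2).
have gc : continuous g.
  move=> t; apply: cvgMr; apply: continuous_comp; last exact: sqrt_continuous.
  by apply: cvgB; [exact: cvg_cst|exact: exprn_continuous].
have [||c] := @EVT_max R (fun t => F (t +i* g t)) (-1) 1.
- by rewrite (le_trans _ ler01) // oppr_le0.
- apply: continuous_subspaceT => t.
  apply/cvgrPdist_le => d d0; near=> s.
  apply: le_trans (lipF _ _) _.
  have -> : t +i* g t - (s +i* g s) = (t - s) +i* (g t - g s) :> R[i] by simpc.
  apply: le_trans (normc_le_ReIm _ _) _; rewrite (splitr d) lerD //; near: s.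
    by have /cvgrPdist_le := @cvg_id _ (nbhs t); apply; rewrite divr_gt0.
  by have /cvgrPdist_le := gc t; apply; rewrite divr_gt0.
- rewrite in_itv /= => c1 cmax; by exists c.
Unshelve. all: by end_near.
Qed.

Lemma circle_max F : (forall l m, `|F l - F m| <= rnorm (l - m : R[i]^o)) ->
  exists2 l, `|l| = 1 & forall m, `|m| = 1 -> F m <= F l.
Proof.
move=> lipF; have [c c1 cmax] := arc_max 1 lipF; have [d d1 dmax] := arc_max (-1) lipF.
have unit1 (e t : R) : e ^+ 2 = 1 -> -1 <= t <= 1 ->
    `|t +i* (e * Num.sqrt (1 - t ^+ 2)) : R[i]| = 1.
  move=> e1 t1; rewrite normc_def /= exprMn e1 mul1r sqr_sqrtr; last by nra.
  by rewrite addrC subrK sqrtr1.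
have cover m : `|m| = 1 -> -1 <= complex.Re m <= 1 /\
    (m = complex.Re m +i* (1 * Num.sqrt (1 - complex.Re m ^+ 2)) \/
     m = complex.Re m +i* (-1 * Num.sqrt (1 - complex.Re m ^+ 2))).
  case: m => x y; move=> m1; have /eqP := add_Re2_Im2 (x +i* y).
  rewrite m1 expr1n -(rmorph1 (real_complex R)) => /eqP /complexI /= xy.
  have -> : 1 - x ^+ 2 = y ^+ 2 by rewrite -xy; ring.
  split; first by nra.
  rewrite sqrtr_sqr; have [y0|y0] := leP 0 y; [left|right].
    by rewrite mul1r ger0_norm.
  by rewrite mulN1r ltr0_norm // opprK.
have [Fcd|Fdc] := leP (F (c +i* (1 * Num.sqrt (1 - c ^+ 2))))
    (F (d +i* (-1 * Num.sqrt (1 - d ^+ 2)))).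
  exists (d +i* (-1 * Num.sqrt (1 - d ^+ 2))); first by rewrite unit1 // sqrrN expr1n.
  move=> m /cover[m1 [->|->]]; last exact: dmax.
  by apply: le_trans Fcd; apply: cmax.
exists (c +i* (1 * Num.sqrt (1 - c ^+ 2))); first by rewrite unit1 // expr1n.
move=> m /cover[m1 [->|->]]; first exact: cmax.
by apply: le_trans (ltW Fdc); apply: dmax.
Qed.

End CircleMax.

(** * Numerical radius and norm *)

Section Key.
Context (R : realType) (A : cstarAlgType R).
Implicit Types (x y u v a b h q : A) (f g : {linear A -> R[i]^o}).

(** A state [g] norming [|q| - q] gives [| |q| - q | = |q| - g q <= |q|], so [|q|] is a scale for
    [q]. *)
Lemma positive_elt_of_states q : star q = q ->
  (forall g, state_space g -> 0 <= complex.Re (g q)) -> positive_elt q.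
Proof.
move=> qE gq; split=> //; exists (rnorm q); first exact: rnorm_ge0.
have [g sg gb] := state_norming (rscalarB_positive qE (lexx _)).
have [_ g1] := (state_spaceP g).1 sg.
have := gq g sg; move: gb; rewrite linearB linearZ /= g1.
case: (g q) => c d /= [<-]; rewrite mulr1; lra.
Qed.

(** The element equals [r (k - q) r] for the root [r] of [q]. It yields [f (q^2) <= k f q]: if [f q]
    is small, [q] almost annihilates the GNS vector. *)
Lemma positive_quad k q : positive_elt q -> positive_elt (rscalar A k - q) ->
  positive_elt (k%:C *: q - q * q).
Proof.
move=> pq pkq; have [r [[rE _] rr rc]] := positive_sqrt pq.
have -> : k%:C *: q - q * q = r * (rscalar A k - q) * r.
  by rewrite mulrBr mulrBl mul_rscalarr -scalerAl -rr !mulrA.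
apply: positive_conj => //; rewrite mulrBr mulrBl mul_rscalarr mul_rscalarl -rr.
by rewrite mulrA.
Qed.

(** The vector state of [u x], where [x] is the GNS vector of [f], normalized by the squared length
    of [u x]. *)
Lemma conj_state f u : positive_functional f ->
  0 < complex.Re (f (star u * u)) ->
  exists2 g, state_space g &
    forall x, f (star u * x * u) = (complex.Re (f (star u * u)))%:C * g x :> R[i].
Proof.
move=> pf; set c := complex.Re _ => c0.
have [|g gE] := @linear_ex R A (fun x => (c^-1)%:C * f (star u * x * u)).
  move=> l x y; rewrite mulrDr mulrDl -scalerAr -scalerAl linearD linearZ /=.
  by rewrite mulrDr mulrCA.
exists g; last first.
  by move=> x; rewrite gE mulrA -rmorphM mulfV ?gt_eqF // mul1r.
apply/state_spaceP; split=> [x|].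
  rewrite gE; apply: mulr_ge0; first by rewrite ler0c invr_ge0 ltW.
  have -> : star u * (star x * x) * u = star (x * u) * (x * u) by rewrite starM !mulrA.
  exact: pf.
rewrite gE mulr1 -(RRe_real (ger0_real (pf u))) -rmorphM -/c mulVf ?gt_eqF //.
Qed.

Lemma rnormcM (c d : R[i]) : rnorm (c * d : R[i]^o) = rnorm (c : R[i]^o) * rnorm (d : R[i]^o).
Proof.
apply: rnorm_eq; rewrite normrM rmorphM /=.
by rewrite (rnormE (c : R[i]^o)) (rnormE (d : R[i]^o)).
Qed.

Lemma state_bounds f a : state_space f ->
  rnorm (f a) <= rnorm a /\ 0 <= complex.Re (f (star a * a)) <= rnorm a ^+ 2.
Proof.
move=> /state_spaceP[pf f1]; split; first exact: positive_functional_contract.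
rewrite positive_functional_sqr_le // andbT.
by have := pf a; rewrite lecE => /andP[].
Qed.

Lemma Re_le_rnorm (c : R[i]) : complex.Re c <= rnorm (c : R[i]^o).
Proof.
have := normc_ge_Re c; rewrite (rnormE (c : R[i]^o)) lecR; apply: le_trans.
exact: ler_norm.
Qed.

Lemma rnorm_functional_star f x : positive_functional f ->
  rnorm (f (star x)) = rnorm (f x).
Proof.
by move=> pf; rewrite positive_functional_star // /rnorm norm_conjC.
Qed.

(** Parallelogram law: the discarded term is the nonnegative value of [f] at the square of
    [h + z q]. *)
Lemma positive_functional_sumsq f h q (z : R[i]) : positive_functional f ->
  star h = h -> star q = q -> `|z| = 1 ->
  complex.Re (f (star (- h + z *: q) * (- h + z *: q))) <=
  2 * complex.Re (f (h * h)) + 2 * complex.Re (f (q * q)).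
Proof.
move=> pf hE qE z1.
have : 0 <= complex.Re (f (star (h + z *: q) * (h + z *: q))).
  by have := pf (h + z *: q); rewrite lecE => /andP[].
rewrite !starD starN cstarZ hE qE.
have -> : f ((h + Num.conj z *: q) * (h + z *: q)) = f (h * h) + Num.conj z * f (q * h)
    + (z * f (h * q) + f (q * q)) :> R[i].
  rewrite mulrDr !mulrDl -!scalerAl -!scalerAr !scalerA -normCKC z1 expr1n scale1r.
  by rewrite !(linearD f) !linearZ.
have -> : f ((- h + Num.conj z *: q) * (- h + z *: q)) = f (h * h) - Num.conj z * f (q * h)
    + (- (z * f (h * q)) + f (q * q)) :> R[i].
  rewrite mulrDr !mulrDl !mulrN !mulNr opprK -!scalerAl -!scalerAr.
  by rewrite !scalerA -normCKC z1 expr1n scale1r !(linearD f) !(linearN f) !linearZ.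
case: (f (h * h)) (f (q * q)) => [c1 c2] [d1 d2] /=.
by case: (z * _) (Num.conj z * _) => [e1 e2] [g1 g2] /=; lra.
Qed.

(* In the GNS picture with cyclic vector [x], [a^* (a - z) x] is close to
   [z (a - z) x] for the unimodular root [z] of [z^2 - 2 w z + 1 = 0], so that
   [a^*] almost has the eigenvalue [z]. *)
Lemma numerical_radius_gap a f (w alpha beta : R) : rnorm a = 1 -> 0 <= w <= 1 ->
  (forall g, state_space g -> rnorm (g a) <= w) -> state_space f ->
  f a = (w - alpha)%:C -> complex.Re (f (star a * a)) = 1 - beta ->
  (1 - w) ^+ 2 * (2 * (1 - w ^+ 2) - beta) <= 2 * beta + 16 * alpha.
Proof.
move=> a1 /andP[w0 w1] bound sf fa fb; have [pf f1] := (state_spaceP f).1 sf.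
have alpha0 : 0 <= alpha.
  have := le_trans (Re_le_rnorm _) (bound f sf).
  by rewrite fa /=; lra.
pose q := rscalar A (2 * w) - (a + star a).
have qE : star q = q by rewrite starB star_rscalar starD starK [star a + _]addrC.
have ReQ g : state_space g -> complex.Re (g q) = 2 * (w - complex.Re (g a)).
  move=> /state_spaceP[pg g1].
  have -> : g q = (2 * w)%:C - (g a + Num.conj (g a : R[i])) :> R[i].
    by rewrite linearB linearD linearZ /= g1 positive_functional_star // [_ *: _]mulr1.
  by rewrite conj_conjc; case: (g a) => c d /=; ring.
have pq : positive_elt q.
  apply: positive_elt_of_states => // g sg; rewrite ReQ //.
  by have := le_trans (Re_le_rnorm _) (bound g sg); lra.
have q4 : rnorm q <= 4.
  apply: le_trans (ler_rnormB _ _) _; rewrite rnorm_rscalar ger0_norm; last by lra.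
  by have := ler_rnormD a (star a); rewrite rnorm_star a1; lra.
(* The constant is [4 * 2], from [|q| <= 4] and [f q = 2 alpha]. *)
have fqq : complex.Re (f (q * q)) <= 8 * alpha.
  have := positive_functional_elt pf (positive_quad pq (rscalarB_positive qE q4)).
  rewrite linearB linearZ /= lecE => /andP[_] /=.
  have := ReQ f sf; rewrite fa.
  case: (f q) (f (q * q)) => [c d] [c' d'] /= ->; lra.
pose p := 1 - star a * a.
have aaE : star (star a * a) = star a * a by rewrite starM starK.
have pE : star p = p by rewrite starB star1 aaE.
have pp : positive_elt p.
  by rewrite /p -(rscalar1 A); apply: rscalarB_positive; rewrite // rnorm_star_mul a1 expr1n.
have fpp : complex.Re (f (p * p)) <= beta.
  have p1 : positive_elt (rscalar A 1 - p).
    by rewrite rscalar1 subKr; exact: star_mul_positive.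
  have := positive_functional_elt pf (positive_quad pp p1).
  rewrite scale1r linearB /= lecE => /andP[_] /=.
  have : complex.Re (f p) = beta.
    rewrite linearB f1 /=; move: fb; case: (f _) => c d /= ->; ring.
  by case: (f p) (f (p * p)) => [c d] [c' d'] /= ->; lra.
pose z : R[i] := w +i* Num.sqrt (1 - w ^+ 2).
have zz : z * z = (2 * w)%:C * z - 1.
  have := @sqr_sqrtr R (1 - w ^+ 2); rewrite /z; move: (Num.sqrt _) => s ss.
  have {}ss : s * s = 1 - w * w by rewrite -!expr2 ss //; nra.
  by apply/eqP; rewrite eq_complex /= ss; apply/andP; split; apply/eqP; ring.
have z1 : `|z| = 1.
  rewrite normc_def /= sqr_sqrtr; first by rewrite addrC subrK sqrtr1.
  by rewrite subr_ge0 expr2; nra.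
pose u := a - z *: 1; pose r := - p + z *: q.
(* The equation [z^2 = 2 w z - 1] cancels the scalar terms and leaves the remainder [r], which is
   small at [f] by the bounds on [p] and [q]. *)
have ur : star a * u = z *: u + r.
  rewrite /r /p /q /u mulrBr -scalerAr mulr1 !scalerBr !scalerDr !scalerA zz scalerBl.
  rewrite scale1r [z * _]mulrC !opprB !opprD.
  move: (_ *: 1) (z *: a) (z *: star a) (star a * a) => D C B X.
  by rewrite [RHS]addrACA subrKA [C + _]addrA subrKA addrACA subrr add0r.
pose N := complex.Re (f (star u * u)).
have NE : N = 2 * (1 - w * (w - alpha)) - beta.
  have -> : N = complex.Re (f (star a * a) - Num.conj z * (w - alpha)%:C
      - (z * Num.conj (w - alpha)%:C - 1)).
    rewrite /N /u starB cstarZ star1 mulrBr !mulrBl -!scalerAl -!scalerAr mul1r !mulr1.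
    rewrite scalerA -normCKC z1 expr1n scale1r; congr complex.Re.
    by rewrite !(linearB f) !linearZ /= f1 positive_functional_star // fa scalerN.
  rewrite !conj_conjc.
  move: fb; rewrite /z; case: (f (star a * a)) => c d /= ->; ring.
have N0 : 0 <= N by have := pf u; rewrite lecE => /andP[].
have frr : complex.Re (f (star r * r)) <= 2 * beta + 16 * alpha.
  by have := positive_functional_sumsq pf pE qE z1; rewrite -/r; lra.
(* The radius bound for the vector state of [u]; when [N = 0] that state does not exist and
   Cauchy-Schwarz gives 0 directly. *)
have fu : rnorm (f (star u * star a * u)) <= w * N.
  have [N1|N1] := eqVneq N 0.
    have := positive_functional_CS u (star a * u) pf.
    rewrite -/N N1 mul0r mulr0 mulrA => H.
    rewrite -(ler_pXn2r (ltn0Sn 1)) ?nnegrE ?rnorm_ge0 //.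
    by apply: le_trans H _; rewrite expr0n.
  have Np : 0 < N by rewrite lt_def N1.
  have [g sg gE] := conj_state pf Np; rewrite gE -/N.
  have [pg _] := (state_spaceP g).1 sg.
  rewrite rnormcM rnorm_real gtr0_norm // rnorm_functional_star // mulrC.
  by rewrite ler_wpM2r // bound.
have main : ((1 - w) * N) ^+ 2 <= N * (2 * beta + 16 * alpha).
  have fuE : f (star u * star a * u) = z * f (star u * u) + f (star u * r) :> R[i].
    by rewrite -mulrA ur mulrDr -scalerAr linearD linearZ.
  have NN : N = rnorm (z * f (star u * u) : R[i]^o).
    have z1' : rnorm (z : R[i]^o) = 1 by apply: rnorm_eq; exact: z1.
    rewrite rnormcM z1' mul1r.
    by rewrite /N /rnorm ger0_norm.
  have le_ur : (1 - w) * N <= rnorm (f (star u * r)).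
    rewrite mulrBl mul1r lerBlDl {1}NN.
    have -> : z * f (star u * u) = f (star u * star a * u) - f (star u * r) :> R[i].
      by rewrite fuE addrK.
    by apply: le_trans (ler_rnormB _ _) _; rewrite lerD2r.
  apply: (@le_trans _ _ (rnorm (f (star u * r)) ^+ 2)).
    by rewrite ler_pXn2r ?nnegrE ?rnorm_ge0 ?mulr_ge0 ?subr_ge0.
  apply: le_trans (positive_functional_CS _ _ pf) _.
  by rewrite ler_wpM2l.
have : N * ((1 - w) ^+ 2 * N) <= N * (2 * beta + 16 * alpha).
  by apply: le_trans main; rewrite exprMn mulrCA expr2 [N ^+ 2]expr2 mulrCA.
(* If [N = 0], then [2 (1 - w^2) - beta <= 0], so the left side is nonpositive; otherwise [N] is
   cancelled. *)
have [N1|N1] := eqVneq N 0.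
  move=> _; apply: (@le_trans _ _ 0).
    rewrite -[leRHS](mulr0 ((1 - w) ^+ 2)) ler_wpM2l ?sqr_ge0 //.
    by move: NE; rewrite N1; nra.
  by apply: le_trans frr; have := pf r; rewrite lecE => /andP[].
rewrite ler_pM2l ?lt_def ?N1 //; apply: le_trans.
by rewrite ler_wpM2l ?sqr_ge0 // NE; nra.
Qed.

End Key.

(** * Suprema over states and the two implications *)

Section Radii.
Context (R : realType) (A : cstarAlgType R).
Implicit Types (x y u v a b h q : A) (f g : {linear A -> R[i]^o}).

Lemma state_ex : exists f : {linear A -> R[i]^o}, state_space f.
Proof.
have p1 : positive_elt (1 : A) by have := positive_sqr (star1 A); rewrite mulr1.
by have [f sf _] := state_norming p1; exists f.
Qed.

Lemma rnorm_state_le f a : state_space f -> rnorm (f a) <= numerical_radius a.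
Proof.
move=> sf; apply: ub_le_sup; last by exists f.
by exists (rnorm a) => _ [g sg <-]; have [] := state_bounds a sg.
Qed.

Lemma numerical_radius_le a t : (forall f, state_space f -> rnorm (f a) <= t) ->
  numerical_radius a <= t.
Proof.
move=> H; apply: ge_sup; last by move=> _ [f sf <-]; exact: H.
by have [f sf] := state_ex; exists (rnorm (f a)), f.
Qed.

Lemma state_dw_le f a : state_space f ->
  Num.sqrt (rnorm (f a) ^+ 2 + complex.Re (f (star a * a)) ^+ 2) <=
  Num.sqrt (numerical_radius a ^+ 2 + rnorm a ^+ 4).
Proof.
move=> sf; have [_ /andP[l0 l1]] := state_bounds a sf.
have n0 := rnorm_ge0 (f a); have nw := rnorm_state_le a sf.
have a0 := rnorm_ge0 a.
rewrite ler_sqrt; last by rewrite addr_ge0 // exprn_ge0 // (le_trans n0).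
rewrite (exprM _ 2 2) lerD // ler_pXn2r ?nnegrE ?sqr_ge0 //.
exact: le_trans n0 nw.
Qed.

Lemma dw_attained f a : state_space f ->
  rnorm (f a) = numerical_radius a -> complex.Re (f (star a * a)) = rnorm a ^+ 2 ->
  davis_wielandt_radius a = Num.sqrt (numerical_radius a ^+ 2 + rnorm a ^+ 4).
Proof.
move=> sf e1 e2; apply/eqP; rewrite eq_le; apply/andP; split.
  apply: ge_sup; last by move=> _ [g sg <-]; exact: state_dw_le.
  by exists (Num.sqrt (rnorm (f a) ^+ 2 + complex.Re (f (star a * a)) ^+ 2)), f.
apply: ub_le_sup.
  exists (Num.sqrt (numerical_radius a ^+ 2 + rnorm a ^+ 4)) => _ [g sg <-].
  exact: state_dw_le.
by exists f => //; rewrite e1 e2 -exprM.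
Qed.

(** The two coordinates are bounded by [w] and [M], so a small deficit in the sum of squares is a
    small deficit in each. *)
Lemma dw_max_states a (e : R) : 0 < e ->
  davis_wielandt_radius a = Num.sqrt (numerical_radius a ^+ 2 + rnorm a ^+ 4) ->
  exists2 f, state_space f & numerical_radius a - e <= rnorm (f a) /\
    rnorm a ^+ 2 - e <= complex.Re (f (star a * a)).
Proof.
set w := numerical_radius a; set M := rnorm a ^+ 2; set D := Num.sqrt _ => e0 dwE.
have M0 : 0 <= M by rewrite sqr_ge0.
have D0 : 0 <= D := sqrtr_ge0 _.
have DD : D ^+ 2 = w ^+ 2 + M ^+ 2.
  by rewrite sqr_sqrtr ?addr_ge0 ?sqr_ge0 ?exprn_even_ge0 // /M -exprM.
(* If [S > D - d], then [D^2 - S^2 <= d (2 D + 1) = e^2]; the added 1 avoids a zero denominator. *)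
pose d := e ^+ 2 / (2 * D + 1).
have d0 : 0 < d by rewrite divr_gt0 ?exprn_gt0 //; lra.
have [|_ [f sf <-]] := @sup_adherent R ((fun f : {linear A -> R[i]^o} =>
  Num.sqrt (rnorm (f a) ^+ 2 + complex.Re (f (star a * a)) ^+ 2)) @` (@state_space R A)) d d0.
  split.
    have [f sf] := state_ex.
    by exists (Num.sqrt (rnorm (f a) ^+ 2 + complex.Re (f (star a * a)) ^+ 2)), f.
  exists (Num.sqrt (numerical_radius a ^+ 2 + rnorm a ^+ 4)) => _ [g sg <-].
  exact: state_dw_le.
rewrite -/(davis_wielandt_radius a) dwE => H; exists f => //.
have [_ /andP[]] := state_bounds a sf; rewrite -/M.
move: H (rnorm_ge0 (f a)) (rnorm_state_le a sf); rewrite -/w.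
move: (rnorm (f a)) (complex.Re _) => X Y H X0 Xw Y0 YM.
set S := Num.sqrt _ in H; have S0 : 0 <= S := sqrtr_ge0 _.
have SS : S ^+ 2 = X ^+ 2 + Y ^+ 2 by rewrite sqr_sqrtr ?addr_ge0 ?sqr_ge0.
have dE : d * (2 * D + 1) = e ^+ 2 by rewrite divfK // gt_eqF //; lra.
have gap : w ^+ 2 + M ^+ 2 - (X ^+ 2 + Y ^+ 2) <= e ^+ 2.
  rewrite -DD -SS -dE !expr2.
  have : 0 <= d * D by rewrite mulr_ge0 // ltW.
  have [Dd|dD] := leP D d; first by nra.
  by have : (D - d) * (D - d) <= S * S; [apply: ler_pM; lra|nra].
(* For [0 <= p <= q] one has [(q - p)^2 <= q^2 - p^2]. *)
have sqr_gap (p q : R) : 0 <= p -> p <= q -> q ^+ 2 - p ^+ 2 <= e ^+ 2 -> q - e <= p.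
  move=> p0 pq; rewrite !expr2 => H1.
  suff : q - p <= e by lra.
  rewrite -(ler_pXn2r (ltn0Sn 1)) ?nnegrE ?subr_ge0 ?(ltW e0) // !expr2.
  by nra.
have YY : Y ^+ 2 <= M ^+ 2 by rewrite ler_pXn2r ?nnegrE.
have XX : X ^+ 2 <= w ^+ 2 by rewrite ler_pXn2r ?nnegrE // (le_trans X0).
by split; apply: sqr_gap => //; lra.
Qed.

Lemma phase_ex (c : R[i]) : exists2 l : R[i], `|l| = 1 & l * c = `|c|.
Proof.
have [->|c0] := eqVneq c 0; first by exists 1; rewrite ?normr1 // mulr0 normr0.
exists (Num.conj c / `|c|).
  by rewrite normrM normfV normr_id norm_conjC mulfV // normr_eq0.
by rewrite mulrAC -normCKC expr2 mulfK // normr_eq0.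
Qed.

Lemma contractive_radius_ge1 a (w : R) : rnorm a = 1 -> 0 <= w ->
  (forall g, state_space g -> rnorm (g a) <= w) ->
  (forall e : R, 0 < e -> exists2 f, state_space f &
     w - e <= rnorm (f a) /\ 1 - e <= complex.Re (f (star a * a))) ->
  1 <= w.
Proof.
move=> a1 w0 bound approx; rewrite leNgt; apply/negP => w1.
pose d := 1 - w; have d0 : 0 < d by rewrite /d; lra.
(* With both errors at most [e], [numerical_radius_gap] gives [2 d^3 - d^2 e <= 18 e]; as
   [d^3 = 19 e] and [d <= 1], this would mean [37 e <= 18 e]. *)
pose e := d ^+ 3 / 19.
have e0 : 0 < e by rewrite divr_gt0 // exprn_gt0.
have [f sf [fa faa]] := approx e e0.
have [l l1 lfa] := phase_ex (f a).
have ll : Num.conj l * l = 1 by rewrite -normCKC l1 expr1n.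
(* Rotating by the phase makes [f b] real and nonnegative without changing [b^* b] or the bound on
   states. *)
pose b := l *: a.
have rl (c : R[i]) : rnorm (l * c : R[i]^o) = rnorm (c : R[i]^o).
  by rewrite /rnorm normrM l1 mul1r.
have b1 : rnorm b = 1 by rewrite /b /rnorm normrZ l1 mul1r.
have bb : star b * b = star a * a.
  by rewrite /b cstarZ -scalerAl -scalerAr scalerA ll scale1r.
have boundb g : state_space g -> rnorm (g b) <= w.
  by move=> sg; rewrite linearZ rl bound.
have fb : f b = (w - (w - rnorm (f a)))%:C.
  by rewrite subKr linearZ /= [_ *: _]lfa (rnormE (f a)).
have w01 : 0 <= w <= 1 by rewrite w0 ltW.
have := numerical_radius_gap b1 w01 boundb sf fb (esym (subKr 1 _)).
rewrite bb -/d; set al := w - _; set be := 1 - complex.Re _ => H.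
have ale : al <= e by rewrite /al; lra.
have bee : be <= e by rewrite /be; lra.
have wE : w = 1 - d by rewrite /d; ring.
have d1 : d <= 1 by rewrite /d; lra.
have : d ^+ 2 * (2 * d - e) <= 18 * e.
  apply: le_trans (_ : 2 * be + 16 * al <= _); last by lra.
  apply: le_trans H; rewrite ler_wpM2l ?sqr_ge0 // wE.
  by nra.
have eE : d ^+ 3 = 19 * e by rewrite /e; field.
have : d ^+ 2 * e <= e by rewrite ler_piMl ?(ltW e0) // expr_le1 // ltW.
have -> : d ^+ 2 * (2 * d - e) = 2 * d ^+ 3 - d ^+ 2 * e by ring.
by rewrite eE; lra.
Qed.

Lemma dw_max_normaloid a : a != 0 ->
  davis_wielandt_radius a = Num.sqrt (numerical_radius a ^+ 2 + rnorm a ^+ 4) ->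
  numerical_radius a = rnorm a.
Proof.
move=> a0 dwE; apply/eqP; rewrite eq_le; apply/andP; split.
  by apply: numerical_radius_le => f sf; have [] := state_bounds a sf.
have M0 : 0 < rnorm a.
  by rewrite lt_def rnorm_ge0 andbT; apply: contra a0 => /eqP/rnorm_eq0 ->.
set M := rnorm a in M0 *; set w := numerical_radius a.
pose b := (M^-1)%:C *: a.
have Mi : 0 < M^-1 by rewrite invr_gt0.
have fb g : rnorm (g b) = M^-1 * rnorm (g a).
  by rewrite linearZ rnormcM rnorm_real gtr0_norm.
have w0 : 0 <= w.
  by have [f sf] := state_ex; apply: le_trans (rnorm_state_le a sf); exact: rnorm_ge0.
rewrite -(ler_pM2l Mi) mulVf ?gt_eqF //.
apply: (@contractive_radius_ge1 b).
- by rewrite rnormZr gtr0_norm // mulVf ?gt_eqF.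
- by rewrite mulr_ge0 // ltW.
- by move=> g sg; rewrite fb ler_pM2l // rnorm_state_le.
(* Normalizing divides the error on [f a] by [M] and the error on [f (a^* a)] by [M^2]. *)
move=> e e0; pose d := Num.min (M * e) (M ^+ 2 * e).
have d0 : 0 < d by rewrite lt_min !mulr_gt0 // exprn_gt0.
have [f sf [f1 f2]] := dw_max_states d0 dwE; exists f => //; split.
  rewrite fb ler_pdivlMl // mulrBr mulrA mulfV ?gt_eqF // mul1r.
  by apply: le_trans f1; rewrite lerB // ge_min lexx.
have -> : complex.Re (f (star b * b)) = M^-1 ^+ 2 * complex.Re (f (star a * a)).
  rewrite /b starZr -scalerAl -scalerAr scalerA -rmorphM linearZ /= -expr2.
  by case: (f _) => c d' /=; ring.
rewrite exprVn ler_pdivlMl ?exprn_gt0 // mulrBr mulr1.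
by apply: le_trans f2; rewrite lerB // ge_min lexx orbT.
Qed.

(** Each state [f] has its own phase [m], with [|f a| + 1 <= |a + m^*|]. A maximizer [l] of
    [|a + l|] on the circle dominates all of these, and the supremum over states follows. *)
Lemma normaloid_parallel1 a : numerical_radius a = rnorm a -> norm_parallel a 1.
Proof.
move=> wE; pose F (l : R[i]) := rnorm (a + l *: 1).
have [|l l1 lmax] := @circle_max R F.
  move=> l m; rewrite /F.
  have lm : rnorm (l *: 1 - m *: 1 : A) = rnorm (l - m : R[i]^o).
    by rewrite -scalerBl rnormZ rnorm1 mulr1.
  have half x y : rnorm (a + x) - rnorm (a + y) <= rnorm (x - y).
    rewrite lerBlDl; have -> : a + x = a + y + (x - y) by rewrite -addrA [y + _]addrCA subrr addr0.
    exact: ler_rnormD.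
  have := half (l *: 1) (m *: 1); have := half (m *: 1) (l *: 1).
  by rewrite (rnormBC (m *: 1 : A)) lm ler_norml => h1 h2; rewrite h2 andbT; lra.
exists l; split => //.
rewrite !rnormE -rmorphD rnorm1; congr (_%:C); apply/eqP; rewrite eq_le; apply/andP; split.
  apply: le_trans (ler_rnormD _ _) _; rewrite rnormZ rnorm1 mulr1 lerD2l.
  by rewrite /rnorm l1.
rewrite -lerBrDr -wE; apply: numerical_radius_le => f sf.
have [m m1 mfa] := phase_ex (f a).
have [pf f1] := (state_spaceP f).1 sf.
rewrite lerBrDr; apply: le_trans (lmax (Num.conj m) _); last by rewrite norm_conjC.
apply: le_trans (positive_functional_contract _ pf f1).
rewrite linearD linearZ /= f1 [_ *: _]mulr1.
have mm : m * Num.conj m = 1 by rewrite -normCK m1 expr1n.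
have -> : rnorm (f a + Num.conj m : R[i]^o) = rnorm (m * (f a + Num.conj m) : R[i]^o).
  by rewrite /rnorm normrM m1 mul1r.
rewrite mulrDr mfa mm (rnormE (f a)) -(rmorph1 (real_complex R)) -rmorphD rnorm_real.
exact: ler_norm.
Qed.

Lemma parallel1_dw a : norm_parallel a 1 ->
  davis_wielandt_radius a = Num.sqrt (numerical_radius a ^+ 2 + rnorm a ^+ 4).
Proof.
move=> [l [l1 al]]; set M := rnorm a.
have ll : Num.conj l * l = 1 by rewrite -normCKC l1 expr1n.
have cM : rnorm (a + l *: 1) = M + 1.
  by apply: rnorm_eq; rewrite al !rnormE rnorm1 rmorphD.
have [f sf fc] := state_norming (star_mul_positive (a + l *: 1)).
have [fa /andP[_ faa]] := state_bounds a sf; rewrite -/M in fa faa.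
have [pf f1] := (state_spaceP f).1 sf.
have Rel : complex.Re (Num.conj l * f a) <= rnorm (f a).
  apply: le_trans (Re_le_rnorm _) _.
  by rewrite /rnorm normrM norm_conjC l1 mul1r.
(* The three terms are at most [M^2], [2 M] and 1, whose sum is [(M + 1)^2], so each bound is an
   equality. *)
have : complex.Re (f (star a * a)) + 2 * complex.Re (Num.conj l * f a) + 1 = (M + 1) ^+ 2.
  have fE : f (star (a + l *: 1) * (a + l *: 1)) = f (star a * a) + Num.conj l * f a
      + (Num.conj (Num.conj l * f a) + 1) :> R[i].
    rewrite starD cstarZ star1 mulrDr !mulrDl -!scalerAl -!scalerAr mul1r !mulr1.
    rewrite scalerA ll scale1r !(linearD f) !linearZ /= f1 positive_functional_star //.
    by rewrite rmorphM /= conjCK.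
  move: fc; rewrite fE rnorm_star_mul cM conj_conjc => /(congr1 (@complex.Re R)) /= <-.
  by case: (f (star a * a)) (Num.conj l * f a) => [c d] [c' d'] /=; ring.
rewrite sqrrD1 => H.
have faM : rnorm (f a) = M by apply/eqP; rewrite eq_le fa /=; lra.
apply: (dw_attained sf); last by lra.
rewrite faM; apply/eqP; rewrite eq_le; apply/andP; split.
  by rewrite -faM rnorm_state_le.
by apply: numerical_radius_le => g sg; have [] := state_bounds a sg.
Qed.

End Radii.

Theorem theorem4p4 (R : realType) (A : cstarAlgType R) (a : A) (ha : a != 0) :
  norm_parallel a 1 <->
  davis_wielandt_radius a =
    Num.sqrt (numerical_radius a ^+ 2 + rnorm a ^+ 4).
Proof.
split; first exact: parallel1_dw.
by move/(dw_max_normaloid ha)/normaloid_parallel1.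
Qed.
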